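(* Fix integers $N\ge 1$, $n\ge 1$ and a real number $\alpha>0$, and let all objects be as in the context. For every $\mathbf m\in\mathcal M_N$ the map $U^{\mathbf m}_{(-)}$ sends $W^{\mathbf m}_{(-)}$ into $F^{\mathbf m}$, and $U^{\mathbf m}_{(-)}:W^{\mathbf m}_{(-)}\to F^{\mathbf m}$ is an isomorphism of $Y(\mathfrak{gl}_n)$-modules; that is, it is a linear bijection and $U^{\mathbf m}_{(-)}\,T^{W,-}_{a,b}(u)\,w=T^{(-)}_{a,b}(u)\,U^{\mathbf m}_{(-)}\,w$ for all $w\in W^{\mathbf m}_{(-)}$ and all $a,b=1,\dots,n$ (coefficientwise in $u^{-1}$).
   Context: Let $\mathcal H=\mathbb C[z_1^{\pm1},\dots,z_N^{\pm1}]\otimes(\mathbb C^n)^{\otimes N}$ with a fixed basis $v_1,\dots,v_n$ of $\mathbb C^n$. For $\sigma\in\mathfrak S_N$ define operators on $\mathcal H$ by $K_\sigma\, z_1^{m_1}\cdots z_N^{m_N}\otimes v_{\epsilon_1}\otimes\cdots\otimes v_{\epsilon_N}=z_1^{m_{\sigma(1)}}\cdots z_N^{m_{\sigma(N)}}\otimes v_{\epsilon_1}\otimes\cdots\otimes v_{\epsilon_N}$ and $P_\sigma\, z_1^{m_1}\cdots z_N^{m_N}\otimes v_{\epsilon_1}\otimes\cdots\otimes v_{\epsilon_N}=z_1^{m_1}\cdots z_N^{m_N}\otimes v_{\epsilon_{\sigma(1)}}\otimes\cdots\otimes v_{\epsilon_{\sigma(N)}}$; write $K_{i,j},P_{i,j}$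 for transpositions $(i,j)$. Let $\mathcal H^{(-)}=\bigcap_{i=1}^{N-1}\mathrm{Ker}(K_{i,i+1}P_{i,i+1}+1)$. The Dunkl operators (acting on the polynomial factor) are $d_i=\alpha z_i\frac{\partial}{\partial z_i}-i+\sum_{j>i}\frac{z_j}{z_j-z_i}(K_{i,j}-1)-\sum_{j<i}\frac{z_i}{z_i-z_j}(K_{i,j}-1)$, $i=1,\dots,N$. Define $\hat T_0(u)=\left(1+\frac{P_{0,1}}{u+d_1}\right)\left(1+\frac{P_{0,2}}{u+d_2}\right)\cdots\left(1+\frac{P_{0,N}}{u+d_N}\right)\in \mathrm{End}(\mathbb C^n)\otimes\mathrm{End}(\mathcal H)[[u^{-1}]]$, where the extra copy $\mathbb C^n$ is labeled $0$ and $P_{0,i}$ permutes tensor factors $0$ and $i$ of $(\mathbb C^n)^{\otimes(N+1)}$; write $\hat T_0(u)=\sum_{a,b}E_{a,b}\otimes\hat T_{a,b}(u)$ with $E_{a,b}$ matrix units. The coefficients of $\hat T_{a,b}(u)$ preserve $\mathcal H^{(-)}$; $T^{(-)}_{a,b}(u)$ denotes their restriction to $\mathcal H^{(-)}$ (they satisfy the defining relations of the Yangian $Y(\mathfrak{gl}_n)$). Let $\mathcal M_N=\{\mathbf m=(m_1,\dots,m_N)\in\mathbb Z^N: m_1\ge\cdots\ge m_N\}$. For $\mathbf m\in\mathcal M_N$ let $S^{\mathbf m}\subset\mathfrak S_N$ be the set of $\sigma$ such that for all $i$, $\sigma(i)=\#\{j\le i: m_{\sigma(j)}\ge m_{\sigma(i)}\}+\#\{j>i: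 m_{\sigma(j)}>m_{\sigma(i)}\}$. Put $\xi^{\mathbf m}_i(\sigma)=\alpha m_{\sigma(i)}-\sigma(i)$ and $\xi^{\mathbf m}_i=\xi^{\mathbf m}_i(\mathrm{id})=\alpha m_i-i$. For $\sigma\in S^{\mathbf m}$, $\Phi^{\mathbf m}_\sigma(z)$ (non-symmetric Jack polynomial) is the unique Laurent polynomial which is a simultaneous eigenvector of $d_1,\dots,d_N$ with eigenvalues $d_i\Phi^{\mathbf m}_\sigma=\xi^{\mathbf m}_i(\sigma)\Phi^{\mathbf m}_\sigma$ and in which the monomial $z_1^{m_{\sigma(1)}}\cdots z_N^{m_{\sigma(N)}}$ has coefficient $1$; these polynomials form a basis of $\mathbb C[z^{\pm1}]$. Let $E^{\mathbf m}=\bigoplus_{\sigma\in S^{\mathbf m}}\mathbb C\Phi^{\mathbf m}_\sigma$ and $F^{\mathbf m}=(E^{\mathbf m}\otimes(\mathbb C^n)^{\otimes N})\cap\mathcal H^{(-)}$; $F^{\mathbf m}$ is invariant under $T^{(-)}_{a,b}(u)$. Let $\check R_{i,i+1}(u)=u^{-1}+P_{i,i+1}\in\mathrm{End}((\mathbb C^n)^{\otimes N})$. Define $\check{\mathbb R}^{(-)}(\sigma)$, $\sigma\in S^{\mathbf m}$, by $\check{\mathbb R}^{(-)}(\mathrm{id})=1$ and $\check{\mathbb R}^{(-)}(\sigma\circ(i,i+1))=-\check R_{i,i+1}\big(\xi^{\mathbf m}_i(\sigma)-\xi^{\mathbf m}_{i+1}(\sigma)\big)\check{\mathbb R}^{(-)}(\sigma)$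 whenever $\sigma\in S^{\mathbf m}$ and $m_{\sigma(i)}>m_{\sigma(i+1)}$ (then $\sigma\circ(i,i+1)\in S^{\mathbf m}$; this recursion defines $\check{\mathbb R}^{(-)}$ unambiguously on all of $S^{\mathbf m}$). Define $U^{\mathbf m}_{(-)}:(\mathbb C^n)^{\otimes N}\to\mathcal H$ by $U^{\mathbf m}_{(-)}v=\sum_{\sigma\in S^{\mathbf m}}\Phi^{\mathbf m}_\sigma(z)\otimes\check{\mathbb R}^{(-)}(\sigma)v$. Let $W^{\mathbf m}_{(-)}=\bigcap_{i:\,m_i=m_{i+1}}\mathrm{Ker}(P_{i,i+1}+1)\subset(\mathbb C^n)^{\otimes N}$, a $Y(\mathfrak{gl}_n)$-module via $T^{W,-}_0(u)=\sum_{a,b}E_{a,b}\otimes T^{W,-}_{a,b}(u):=\left(1+\frac{P_{0,1}}{u+\xi^{\mathbf m}_1}\right)\cdots\left(1+\frac{P_{0,N}}{u+\xi^{\mathbf m}_N}\right)$. *)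

(* Defs.v *)
From HB Require Import structures.
From mathcomp Require Import all_boot all_order all_algebra all_fingroup.
From mathcomp Require Import finmap.
From mathcomp Require Import monalg.
Set Implicit Arguments. Unset Strict Implicit. Unset Printing Implicit Defensive.
Import Order.TTheory GRing.Theory Num.Theory.
Local Open Scope ring_scope.

Section Defs.
Variables (C : numClosedFieldType) (N n : nat).

Definition expo := {ffun 'I_N -> int}.
(* basis words (eps_1,...,eps_N) of (C^n)^{(x)N}; v_{eps_1} (x) ... (x) v_{eps_N} *)
Definition word := {ffun 'I_N -> 'I_n}.
(* Laurent polynomials C[z_1^{+-1},...,z_N^{+-1}] : finitely supported
   coefficient functions on exponent vectors *)
Definition Lpoly := {malg C[expo]}.
(* X (x) (C^n)^{(x)N}, written as functions word -> X:
   h = \sum_eps h(eps) (x) v_eps *)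
Definition tens (X : lmodType C) := {ffun word -> X}.
Definition Vsp := tens C^o.
Definition Hsp := tens Lpoly.

Definition zmon (m : expo) : Lpoly := << m >>.

Definition lext (f : expo -> Lpoly) (g : Lpoly) : Lpoly :=
  \sum_(k <- msupp g) g@_k *: f k.

(* P_sigma on X (x) (C^n)^{(x)N}: v_eps |-> v_{eps o sigma} *)
Definition Pperm (X : lmodType C) (s : {perm 'I_N}) (h : tens X) : tens X :=
  [ffun eta : word => h [ffun k => eta ((s^-1)%g k)]].

(* E_{c,d} acting on the i-th tensor factor: E_{c,d} v_e = delta_{d,e} v_c *)
Definition Eu (X : lmodType C) (i : 'I_N) (c d : 'I_n) (h : tens X) : tens X :=
  [ffun eta : word => if eta i == c
                      then h [ffun k => if k == i then d else eta k] else 0].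

Definition Kpoly (s : {perm 'I_N}) : Lpoly -> Lpoly :=
  lext (fun m => zmon [ffun k => m (s k)]).
Definition KH (s : {perm 'I_N}) (h : Hsp) : Hsp := [ffun eta => Kpoly s (h eta)].

Definition euler (i : 'I_N) : Lpoly -> Lpoly := lext (fun m => (m i)%:~R *: zmon m).

Definition upd2 (m : expo) (p : 'I_N) (v : int) (q : 'I_N) (w : int) : expo :=
  [ffun k => if k == p then v else if k == q then w else m k].

(* the divided difference  y/(y-x) (K_{p,q} - 1)  with y = z_p, x = z_q,
   written out on monomials: if a = m_q, b = m_p then
   y (x^b y^a - x^a y^b)/(y-x) = sgn * \sum_{min(a,b) < k <= max(a,b)} x^{a+b-k} y^k,
   sgn = +1 if a > b, -1 if a < b. *)
Definition ddmon (p q : 'I_N) (m : expo) : Lpoly :=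
  let a := m q in let b := m p in
  let lo := Num.min a b in
  let sgn : C := if b < a then 1 else -1 in
  \sum_(k < `|a - b|%N)
     sgn *: zmon (upd2 m p (lo + k%:Z + 1) q (a + b - (lo + k%:Z + 1))).
Definition dd (p q : 'I_N) : Lpoly -> Lpoly := lext (ddmon p q).

(* Dunkl operators d_i (0-based index i stands for the paper's i+1) *)
Definition dunkl (alpha : C) (i : 'I_N) (f : Lpoly) : Lpoly :=
  alpha *: euler i f - (i.+1)%:R *: f
  + \sum_(j : 'I_N | (i < j)%N) dd j i f
  - \sum_(j : 'I_N | (j < i)%N) dd i j f.
Definition dH (alpha : C) (i : 'I_N) (h : Hsp) : Hsp :=
  [ffun eta => dunkl alpha i (h eta)].

(* formal series in u^{-1} of n x n matrices of operators on tens X: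
   S a b r = coefficient of u^{-r} of the (a,b) matrix entry *)
Definition series (X : lmodType C) := 'I_n -> 'I_n -> nat -> tens X -> tens X.

Definition sone (X : lmodType C) : series X :=
  fun a b r h => if (a == b) && (r == 0)%N then h else 0.

Definition smul (X : lmodType C) (A B : series X) : series X :=
  fun a b r h => \sum_(c < n) \sum_(p < r.+1) A a c p (B c b (r - p)%N h).

(* the factor 1 + P_{0,i}/(u + D):  1/(u+D) = \sum_{k>=0} (-D)^k u^{-k-1},
   and the (a,b) entry of P_{0,i} = \sum_{c,d} E_{c,d} (x) E_{d,c}^{(i)} is E_{b,a}^{(i)} *)
Definition factor (X : lmodType C) (i : 'I_N) (D : tens X -> tens X) : series X :=
  fun a b r h => match r with
                 | 0%N => if a == b then h else 0
                 | r'.+1 => Eu i b a (iter r' (fun x => - D x) h)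
                 end.

Definition Tser (X : lmodType C) (D : 'I_N -> tens X -> tens X) : series X :=
  foldr (@smul X) (@sone X) [seq factor i (D i) | i <- enum 'I_N].

Definition That (alpha : C) : series Lpoly := Tser (dH alpha).

(* xi^m_i(sigma) = alpha m_{sigma(i)} - sigma(i)  (1-based sigma(i)) *)
Definition xi (alpha : C) (m : expo) (s : {perm 'I_N}) (i : 'I_N) : C :=
  alpha * (m (s i))%:~R - ((s i).+1)%:R.

Definition TW (alpha : C) (m : expo) : series C^o :=
  Tser (fun i (v : Vsp) => xi alpha m 1%g i *: v).

Definition nonincr (m : expo) : Prop := forall i j : 'I_N, (i <= j)%N -> m j <= m i.

Definition inS (m : expo) (s : {perm 'I_N}) : bool :=
  [forall i : 'I_N,
     ((s i).+1 == #|[pred j : 'I_N | (j <= i)%N && (m (s i) <= m (s j))%R]|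
                + #|[pred j : 'I_N | (i < j)%N && (m (s i) < m (s j))%R]|)%N].

Definition inHm (h : Hsp) : Prop :=
  forall i j : 'I_N, nat_of_ord j = i.+1 ->
    KH (tperm i j) (Pperm (tperm i j) h) = - h.

(* the conditions characterizing the non-symmetric Jack polynomials Phi^m_sigma *)
Definition PhiSpec (alpha : C) (m : expo) (Phi : {perm 'I_N} -> Lpoly) : Prop :=
  forall s, inS m s ->
    (forall i, dunkl alpha i (Phi s) = xi alpha m s i *: Phi s)
    /\ (Phi s)@_([ffun k => m (s k)] : expo) = 1.

Definition ptens (p : Lpoly) (v : Vsp) : Hsp := [ffun eta => v eta *: p].

Definition Rcheck (i j : 'I_N) (u : C) (v : Vsp) : Vsp :=
  u^-1 *: v + Pperm (tperm i j) v.

Definition RSpec (alpha : C) (m : expo) (R : {perm 'I_N} -> Vsp -> Vsp) : Prop :=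
  (forall v, R 1%g v = v) /\
  (forall (s : {perm 'I_N}) (i j : 'I_N), inS m s -> nat_of_ord j = i.+1 ->
     m (s j) < m (s i) ->
     forall v, R (tperm i j * s)%g v
               = - Rcheck i j (xi alpha m s i - xi alpha m s j) (R s v)).

Definition Umap (m : expo) (Phi : {perm 'I_N} -> Lpoly) (R : {perm 'I_N} -> Vsp -> Vsp)
  (v : Vsp) : Hsp :=
  \sum_(s : {perm 'I_N} | inS m s) ptens (Phi s) (R s v).

Definition inEV (m : expo) (Phi : {perm 'I_N} -> Lpoly) (h : Hsp) : Prop :=
  exists vs : {perm 'I_N} -> Vsp, h = \sum_(s : {perm 'I_N} | inS m s) ptens (Phi s) (vs s).

Definition inF (m : expo) (Phi : {perm 'I_N} -> Lpoly) (h : Hsp) : Prop :=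
  inEV m Phi h /\ inHm h.

Definition inW (m : expo) (v : Vsp) : Prop :=
  forall i j : 'I_N, nat_of_ord j = i.+1 -> m i = m j -> Pperm (tperm i j) v = - v.

End Defs.

(* Main.v *)
(** The Dunkl operators satisfy the degenerate affine Hecke relations
    [K d_i = d_(i+1) K + 1] for [K = K_(i,i+1)], and they are triangular on
    monomials for the order which compares the sum of the squares of the exponents
    first and then penalises large exponents on the right.  Their joint spectrum is
    simple because alpha > 0, so the Hecke relations give
    [K Phi_s = A Phi_s + B Phi_(s o (i,i+1))] with [A = 1 / (xi_i(s) - xi_(i+1)(s))].
    Hence a tensor [sum_s Phi_s (x) v_s] lies in H^(-) iff the [v_s] obey the
    recursion defining R and [P v_s = - v_s] whenever m_s(i) = m_s(i+1); it is thus
    determined by [v_id], and the Yang-Baxter equation propagates the antisymmetry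
    of [v_id] to all the [R(s) v_id].  Finally T(u) acts on the s-component by
    [prod_i (1 + P_(0,i) / (u + xi_i(s)))], and the Yang-Baxter equation shows that
    [R(s)] intertwines these products for id and for s. *)

Require Import Defs.
From HB Require Import structures.
From mathcomp Require Import all_boot all_order all_algebra all_fingroup.
From mathcomp Require Import finmap monalg.
From mathcomp Require Import zify ring.
Import GRing.Theory Num.Theory.
Import Order.TTheory.
Set Implicit Arguments. Unset Strict Implicit. Unset Printing Implicit Defensive.
Local Open Scope ring_scope.

(** * Degenerate affine Hecke relations for abstract Dunkl operators *)

Definition permute_expo N (s : {perm 'I_N}) (k : expo N) : expo N :=
  [ffun i => k (s i)].

(* Reversing the order of summation in the second sum makes the total telescope. *)
Lemma sum_divided_difference (R : numDomainType) (V : lmodType R) (F : int -> V)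
    (a b : int) :
  \sum_(k < `|a - b|%N)
     (if b < a then 1 else -1) *: F (Num.min a b + k%:Z + 1)
  + \sum_(k < `|b - a|%N)
     (if a < b then 1 else -1) *: F (b + a - (Num.min b a + k%:Z + 1))
  = F a - F b.
Proof.
rewrite [X in _ + X](reindex_inj rev_ord_inj) /=.
have -> : `|b - a|%N = `|a - b|%N by lia.
have telescope (c : int) n : \sum_(k < n) (F (c + k.+1%:Z) - F (c + k%:Z)) =
    F (c + n%:Z) - F c.
  rewrite -(big_mkord xpredT (fun k => F (c + k.+1%:Z) - F (c + k%:Z))).
  by rewrite telescope_sumr // addr0.
rewrite -big_split /=; have [ltab|ltba|->] := ltgtP a b.
- transitivity (- \sum_(k < `|a - b|%N) (F (a + k.+1%:Z) - F (a + k%:Z))).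
    rewrite -sumrN; apply: eq_bigr => k _; have ltk := ltn_ord k.
    by rewrite scale1r scaleN1r opprB addrC; congr (F _ - F _); lia.
  by rewrite telescope opprB; congr (F _ - F _); lia.
- rewrite (eq_bigr (fun k : 'I__ => F (b + k.+1%:Z) - F (b + k%:Z))).
    by rewrite telescope; congr (F _ - F _); lia.
  move=> k _; have ltk := ltn_ord k.
  by rewrite scale1r scaleN1r; congr (F _ - F _); lia.
- by rewrite !subrr big_ord0.
Qed.

(* The operators d_i for arbitrary linear e_i, D_{p,q} in place of the Euler
   operators and the divided differences. *)
Section DunklRelations.
Variables (R : fieldType) (V : lmodType R) (N : nat).
Variables (e : 'I_N -> {linear V -> V}) (D : 'I_N -> 'I_N -> {linear V -> V}).
Implicit Types (f g : V) (i j l : 'I_N).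

Definition gen_dunkl (alpha : R) i f : V :=
  alpha *: e i f - (i.+1)%:R *: f
  + \sum_(j : 'I_N | (i < j)%N) D j i f
  - \sum_(j : 'I_N | (j < i)%N) D i j f.

Lemma gen_dunkl_linear alpha i c f g :
  gen_dunkl alpha i (c *: f + g) = c *: gen_dunkl alpha i f + gen_dunkl alpha i g.
Proof.
have sumD (P : pred 'I_N) (F : 'I_N -> {linear V -> V}) :
    \sum_(j | P j) F j (c *: f + g) =
    c *: \sum_(j | P j) F j f + \sum_(j | P j) F j g.
  by rewrite scaler_sumr -big_split; apply: eq_bigr => j _; apply: linearP.
rewrite /gen_dunkl (sumD _ (fun j => D j i)) (sumD _ (fun j => D i j)).
rewrite linearP !scalerDr !scalerN !scalerA (mulrC c alpha) (mulrC c i.+1%:R).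
rewrite [RHS]addrACA -opprD; congr (_ - _).
rewrite [RHS]addrACA; congr (_ + _).
by rewrite [RHS]addrACA -opprD.
Qed.

Variables (i0 j0 : 'I_N) (K : {linear V -> V}).
Hypothesis succ_i0 : nat_of_ord j0 = i0.+1.
Local Notation s := (tperm i0 j0).
Hypothesis K_e : forall l f, K (e l f) = e (s l) (K f).
Hypothesis K_D : forall p q f, K (D p q f) = D (s p) (s q) (K f).
Hypothesis D_antisym : forall f, D i0 j0 f + D j0 i0 f = K f - f.
Hypothesis KK : involutive K.

(** Reindexing both sums by the transposition preserves the shape of the summands and moves all the
    change into the order conditions. *)
Lemma K_gen_dunkl alpha l f : K (gen_dunkl alpha l f) =
  alpha *: e (s l) (K f) - (l.+1)%:R *: K f
  + \sum_(j | (l < s j)%N) D j (s l) (K f)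
  - \sum_(j | (s j < l)%N) D (s l) j (K f).
Proof.
have KZ c g : K (c *: g) = c *: K g by apply: linearZ.
rewrite /gen_dunkl linearB linearD linearB !KZ !(linear_sum K) K_e /=.
congr (_ + _); [congr (_ + _)|congr (- _)].
  rewrite [RHS](reindex_inj (@perm_inj _ s)) /=.
  by apply: eq_big => [j|j _]; rewrite ?tpermK ?K_D.
rewrite [RHS](reindex_inj (@perm_inj _ s)) /=.
by apply: eq_big => [j|j _]; rewrite ?tpermK ?K_D.
Qed.

(** The order conditions differ only at the pair [i0], [j0]: its term sits in the first sum on the
    left and in the second on the right. By [D_antisym] the difference is [K (K f) - K f], and the
    shift of the constant by one cancels [K f], which leaves [f]. *)
Lemma K_gen_dunkl_i alpha f :
  K (gen_dunkl alpha i0 f) = gen_dunkl alpha j0 (K f) + f.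
Proof.
rewrite K_gen_dunkl /gen_dunkl tpermL.
have neq_ij : i0 != j0 by rewrite -val_eqE /= succ_i0 neq_ltn ltnSn.
rewrite (bigD1 i0) /= ?tpermL ?succ_i0 //.
rewrite [X in _ = _ - X + _](bigD1 i0) /= ?succ_i0 //.
have -> : \sum_(j | (i0 < s j)%N && (j != i0)) D j j0 (K f) =
          \sum_(j : 'I_N | (i0.+1 < j)%N) D j j0 (K f).
  apply: eq_bigl => j; case: tpermP => [->|->|/eqP ni /eqP nj].
  - by rewrite eqxx andbF; lia.
  - by rewrite succ_i0; lia.
  - by move: ni nj; rewrite -!val_eqE /= succ_i0; lia.
have -> : \sum_(j : 'I_N | (j < i0.+1)%N && (j != i0)) D j0 j (K f) =
          \sum_(j : 'I_N | (s j < i0)%N) D j0 j (K f).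
  apply: eq_bigl => j; case: tpermP => [->|->|/eqP ni /eqP nj].
  - by rewrite eqxx andbF succ_i0; lia.
  - by rewrite succ_i0; lia.
  - by move: ni nj; rewrite -!val_eqE /= succ_i0; lia.
have := D_antisym (K f); rewrite KK => /(canRL (addrK _)) ->.
rewrite -!natr1 !scalerDl !scale1r.
set x := \sum_(j : 'I_N | (i0.+1 < j)%N) _; set y := \sum_(j | (s j < i0)%N) _.
by rewrite !opprD !addrA [LHS](ACl (1*2*3*5*7*6*8*4)).

Qed.

Lemma K_gen_dunkl_j alpha f :
  K (gen_dunkl alpha j0 f) = gen_dunkl alpha i0 (K f) - f.
Proof.
have := K_gen_dunkl_i alpha (K f); rewrite KK => /(canLR (addrK _)) <-.
by rewrite linearB !KK.
Qed.

Lemma K_gen_dunkl_neq alpha l f : l != i0 -> l != j0 ->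
  K (gen_dunkl alpha l f) = gen_dunkl alpha l (K f).
Proof.
rewrite ![l == _]eq_sym => ni nj; rewrite K_gen_dunkl /gen_dunkl tpermD //.
congr (_ + _); [congr (_ + _)|congr (- _)]; apply: eq_bigl => j.
  by case: tpermP => [->|->|//]; move: ni nj; rewrite -!val_eqE /= succ_i0; lia.
by case: tpermP => [->|->|//]; move: ni nj; rewrite -!val_eqE /= succ_i0; lia.
Qed.

(** This is the intertwiner of the degenerate affine Hecke algebra: the scalar correction absorbs
    the terms [f] and [- f] of the relations at [i0] and [j0], so the two eigenvalues are
    exchanged. *)
Lemma K_eigen_shift alpha (x : 'I_N -> R) f :
    (forall l, gen_dunkl alpha l f = x l *: f) -> x j0 - x i0 != 0 ->
  forall l, let g := K f + (x j0 - x i0)^-1 *: f in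
    gen_dunkl alpha l g = x (s l) *: g.
Proof.
move=> fx nz l /=; set c := _^-1.
rewrite addrC gen_dunkl_linear fx.
have [->|ni] := eqVneq l i0.
  rewrite tpermL.
  have -> : gen_dunkl alpha i0 (K f) = x j0 *: K f + f.
    by rewrite -linearZ /= -fx K_gen_dunkl_j subrK.
  rewrite scalerDr !scalerA addrCA addrC; congr (_ + _).
  rewrite -[X in _ + X]scale1r -scalerDl; congr (_ *: _).
  by rewrite /c; field.
have [->|nj] := eqVneq l j0.
  rewrite tpermR.
  have -> : gen_dunkl alpha j0 (K f) = x i0 *: K f - f.
    by rewrite -linearZ /= -fx K_gen_dunkl_i addrK.
  rewrite scalerDr !scalerA addrCA addrC; congr (_ + _).
  rewrite -scaleN1r -scalerDl; congr (_ *: _).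
  by rewrite /c; field.
rewrite tpermD 1?eq_sym // -K_gen_dunkl_neq // fx scalerDr !scalerA mulrC.
by congr (_ + _); apply: linearZ.
Qed.

End DunklRelations.

(** * Linear operators on Laurent polynomials, given on monomials *)

Section LaurentOperators.
Variables (C : numClosedFieldType) (N : nat).
Implicit Types (k : expo N) (f g : Lpoly C N) (s : {perm 'I_N}) (p q i j l : 'I_N).

(** A larger summation range lets several polynomials share one, as linearity of [lext] requires. *)
Lemma lextEw (F : expo N -> Lpoly C N) (d : {fset expo N}) g :
  (msupp g `<=` d)%fset -> lext F g = \sum_(k <- d) g@_k *: F k.
Proof.
move=> sgd; rewrite /lext (big_fset_incl _ sgd) // => k _ /mcoeff_outdom ->.
by rewrite scale0r.
Qed.

Lemma lext_is_linear (F : expo N -> Lpoly C N) : linear (lext F).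
Proof.
move=> c f g; pose d := (msupp (c *: f + g) `|` (msupp f `|` msupp g))%fset.
rewrite (@lextEw F d (c *: f + g)) ?fsubsetUl //.
rewrite (@lextEw F d f) ?(@lextEw F d g).
- rewrite scaler_sumr -big_split /=; apply: eq_bigr => k _.
  by rewrite mcoeffD mcoeffZ scalerDl scalerA.
- by rewrite /d fsubsetU // fsubsetUr orbT.
- by rewrite /d fsubsetU // fsubsetUl orbT.
Qed.
HB.instance Definition _ (F : expo N -> Lpoly C N) :=
  GRing.isLinear.Build C (Lpoly C N) (Lpoly C N) *:%R (lext F) (lext_is_linear F).

HB.instance Definition _ s := GRing.Linear.copy (@Kpoly C N s) (lext _).
HB.instance Definition _ i := GRing.Linear.copy (@euler C N i) (lext _).
HB.instance Definition _ p q := GRing.Linear.copy (@dd C N p q) (lext _).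

Lemma zmon_coef k k' : (zmon C k)@_k' = (k == k')%:R.
Proof. exact: mcoeffU. Qed.

Lemma lpolyE f : f = \sum_(k <- msupp f) f@_k *: zmon C k.
Proof.
rewrite {1}[f]monalgE; apply: eq_bigr => k _; apply/malgP => k'.
by rewrite mcoeffZ zmon_coef mcoeffU mulr_natr.
Qed.

Lemma lext_zmon (F : expo N -> Lpoly C N) k : lext F (zmon C k) = F k.
Proof.
rewrite (@lextEw F [fset k]%fset) ?msuppU_le // big_seq_fset1.
by rewrite zmon_coef eqxx scale1r.
Qed.

Lemma eq_linear_zmon (F G : {linear Lpoly C N -> Lpoly C N}) :
  (forall k, F (zmon C k) = G (zmon C k)) -> F =1 G.
Proof.
move=> eqFG f; rewrite [f]lpolyE !linear_sum; apply: eq_bigr => k _.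
by rewrite !linearZ /= eqFG.
Qed.

Lemma Kpoly_zmon s k : Kpoly s (zmon C k) = zmon C (permute_expo s k).
Proof. by apply: lext_zmon. Qed.
Lemma euler_zmon i k : euler i (zmon C k) = (k i)%:~R *: zmon C k.
Proof. by apply: lext_zmon. Qed.
Lemma dd_zmon p q k : dd p q (zmon C k) = ddmon C p q k.
Proof. by apply: lext_zmon. Qed.

Lemma permute_expoM s t k :
  permute_expo s (permute_expo t k) = permute_expo (s * t)%g k.
Proof. by apply/ffunP => i; rewrite !ffunE permM. Qed.

Lemma permute_expo1 k : permute_expo 1%g k = k.
Proof. by apply/ffunP => i; rewrite ffunE perm1. Qed.

Lemma Kpoly_tpermK i j : involutive (Kpoly (C := C) (tperm i j)).
Proof.
apply: (@eq_linear_zmon (Kpoly (tperm i j) \o Kpoly (tperm i j)) idfun) => k /=.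
by rewrite !Kpoly_zmon permute_expoM tperm2 permute_expo1.
Qed.

Lemma permute_upd2 i j k p v q w : let s := tperm i j in
  permute_expo s (upd2 k p v q w) = upd2 (permute_expo s k) (s p) v (s q) w.
Proof.
move=> s; apply/ffunP => l; rewrite !ffunE.
by rewrite -!(inj_eq (@perm_inj _ s) (s l)) tpermK.
Qed.

Lemma Kpoly_dd i j p q f : let s := tperm i j in
  Kpoly s (dd p q f) = dd (s p) (s q) (Kpoly s f).
Proof.
move=> s; move: f.
apply: (@eq_linear_zmon (Kpoly s \o dd p q) (dd (s p) (s q) \o Kpoly s)) => k /=.
rewrite Kpoly_zmon !dd_zmon /ddmon !ffunE !tpermK linear_sum /=.
by apply: eq_bigr => e _; rewrite linearZ /= Kpoly_zmon permute_upd2.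
Qed.

Lemma Kpoly_euler i j l f : let s := tperm i j in
  Kpoly s (euler l f) = euler (s l) (Kpoly s f).
Proof.
move=> s; move: f.
apply: (@eq_linear_zmon (Kpoly s \o euler l) (euler (s l) \o Kpoly s)) => k /=.
by rewrite euler_zmon linearZ /= !Kpoly_zmon euler_zmon ffunE tpermK.
Qed.

Lemma dd_antisym p q f : p != q -> dd p q f + dd q p f = Kpoly (tperm p q) f - f.
Proof.
move=> neq_pq; move: f.
apply: (@eq_linear_zmon (dd p q \+ dd q p) (Kpoly (tperm p q) \- idfun)) => k /=.
rewrite !dd_zmon Kpoly_zmon /ddmon.
set a := k q; set b := k p.
(* [F x] runs over the monomials whose exponents at p and q add up to [a + b]. Both divided
   differences are sums along this line, from the given monomial [F b] to its transpose [F a]. *)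
pose F (x : int) := zmon C (upd2 k p x q (a + b - x)).
have -> : zmon C (permute_expo (tperm p q) k) = F a.
  congr zmon; apply/ffunP => l; rewrite !ffunE.
  case: tpermP => [->|->|/eqP/negPf -> /eqP/negPf -> //]; rewrite ?eqxx //.
  by rewrite eq_sym (negPf neq_pq) addrC addKr.
have -> : zmon C k = F b.
  congr zmon; apply/ffunP => l; rewrite !ffunE addrK.
  by case: eqP => [->|_] //; case: eqP => [->|].
have swap x : zmon C (upd2 k q x p (b + a - x)) = F (b + a - x).
  congr zmon; apply/ffunP => l; rewrite !ffunE.
  case: (eqVneq l q) => [->|_]; last by [].
  by rewrite eq_sym (negPf neq_pq); lia.
under [X in _ + X]eq_bigr => x _ do rewrite swap.
exact: sum_divided_difference.
Qed.

Lemma dunkl_linearP (alpha : C) i c f g :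
  dunkl alpha i (c *: f + g) = c *: dunkl alpha i f + dunkl alpha i g.
Proof.
exact: (gen_dunkl_linear (fun l => @euler C N l) (fun p q => @dd C N p q)).
Qed.
HB.instance Definition _ (alpha : C) i :=
  GRing.isLinear.Build C (Lpoly C N) (Lpoly C N) *:%R (dunkl alpha i)
    (dunkl_linearP alpha i).

Lemma dunkl_eigen_shift i j alpha (x : 'I_N -> C) f :
    nat_of_ord j = i.+1 ->
    (forall l, dunkl alpha l f = x l *: f) -> x j - x i != 0 ->
  forall l, let g := Kpoly (tperm i j) f + (x j - x i)^-1 *: f in
    dunkl alpha l g = x (tperm i j l) *: g.
Proof.
move=> ji; have neq_ij : i != j by rewrite -val_eqE /= ji neq_ltn ltnSn.
move=> fx nz l g.
have := @K_eigen_shift C (Lpoly C N) N (@euler C N) (@dd C N) i j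
  (Kpoly (tperm i j)) ji (@Kpoly_euler i j) (@Kpoly_dd i j)
  (fun g => @dd_antisym i j g neq_ij) (@Kpoly_tpermK i j) alpha x f fx nz l.
exact.
Qed.

End LaurentOperators.

(** * Ranks of exponents and the set S^m *)

Section Rank.
Variables (N : nat).
Implicit Types (k : expo N) (s : {perm 'I_N}) (i j l : 'I_N).

(** The order of positions in the stable decreasing sort of [k]. It is reflexive, so that [rank]
    counts from 1. *)
Definition precedes k j i : bool :=
  (k i < k j) || ((k i == k j) && (j <= i)%N).

Definition rank k i : nat := #|[pred j | precedes k j i]|.

Lemma precedes_refl k i : precedes k i i.
Proof. by rewrite /precedes eqxx leqnn orbT. Qed.

Lemma precedes_trans k : transitive (precedes k).
Proof. by move=> j i l; rewrite /precedes; lia. Qed.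

Lemma precedesNl k i j : ~~ precedes k j i -> precedes k i j /\ i != j.
Proof.
move=> nji; split; last by apply: contraNneq nji => ->; rewrite precedes_refl.
by move: nji; rewrite /precedes; lia.
Qed.

Lemma precedes_anti k i j : precedes k i j -> precedes k j i -> i = j.
Proof. by move=> ij ji; apply: val_inj; move: ij ji; rewrite /precedes /=; lia. Qed.

Lemma rankE k i :
  rank k i = (#|[pred j : 'I_N | (j <= i)%N && (k i <= k j)%R]|
              + #|[pred j : 'I_N | (i < j)%N && (k i < k j)%R]|)%N.
Proof.
rewrite /rank -!sum1_card (bigID (fun j : 'I_N => (j <= i)%N)) /=.
by congr (_ + _)%N; apply: eq_bigl => j; rewrite !inE /precedes; lia.
Qed.

(** The two counts in [inS] are the two halves of a rank. An element of S^m is therefore determined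
    by the rearranged vector, through its stable sort. *)
Lemma inSP m s :
  reflect (forall i, (s i).+1 = rank (permute_expo s m) i) (inS m s).
Proof.
have rE i : rank (permute_expo s m) i =
    (#|[pred j : 'I_N | (j <= i)%N && (m (s i) <= m (s j))%R]|
     + #|[pred j : 'I_N | (i < j)%N && (m (s i) < m (s j))%R]|)%N.
  by rewrite rankE; congr (_ + _)%N; apply: eq_card => j; rewrite !inE !ffunE.
by apply: (iffP forallP) => H i; have := H i; rewrite rE => /eqP.
Qed.

Lemma precedes_rank k i j : precedes k j i -> j != i -> (rank k j < rank k i)%N.
Proof.
move=> pji neq_ji; apply: proper_card; apply/properP; split.
  by apply/subsetP => l; rewrite !inE => plj; apply: precedes_trans pji.
exists i; rewrite !inE ?precedes_refl //.
by apply: contra neq_ji => pij; apply/eqP; apply: precedes_anti pij.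
Qed.

End Rank.

(** * Simplicity of the joint spectrum *)

Section Spectrum.
Variables (C : numClosedFieldType) (N : nat) (alpha : C).
Implicit Types (k : expo N) (s : {perm 'I_N}) (i j l : 'I_N).

(** Depends on an exponent vector alone, so it also labels eigenvectors not known to come from S^m;
    on S^m it agrees with [xi]. *)
Definition dunkl_eigenvalue k i : C := alpha * (k i)%:~R - (rank k i)%:R.
Local Notation ev := dunkl_eigenvalue.

Lemma xiE m s i : inS m s -> xi alpha m s i = ev (permute_expo s m) i.
Proof. by move=> /inSP sS; rewrite /xi /ev -sS ffunE. Qed.

Hypothesis alpha_gt0 : 0 < alpha.

(** Since alpha > 0, both terms favour the position that comes first: its exponent is at least as
    large, and its rank is strictly smaller. *)
Lemma eigenvalue_le k i j : (ev k i <= ev k j) = precedes k j i.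
Proof.
have lt_ev a b : precedes k b a -> b != a -> ev k a < ev k b.
  move=> pba neq_ba; apply: ler_ltD.
    rewrite ler_pM2l // ler_int; move: pba; rewrite /precedes; lia.
  by rewrite ltrN2 ltr_nat precedes_rank.
have [pji|/precedesNl[pij neq_ij]] := boolP (precedes k j i).
  by have [->|] := eqVneq j i; [rewrite lexx|move=> /(lt_ev _ _ pji)/ltW].
by rewrite lt_geF // lt_ev.
Qed.

(** The order of the eigenvalues at the various positions recovers the ranks; once these cancel,
    alpha times the exponent is left. *)
Lemma eigenvalue_inj k k' s :
  (forall i, ev k' i = ev k (s i)) -> k' = permute_expo s k.
Proof.
move=> eq_ev; have eq_rank i : rank k' i = rank k (s i).
  rewrite /rank -!sum1_card [RHS](reindex_inj (@perm_inj _ s)) /=.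
  by apply: eq_bigl => j; rewrite !inE -!eigenvalue_le !eq_ev.
apply/ffunP => i; rewrite ffunE; have := eq_ev i.
rewrite /ev eq_rank => /addIr /(mulfI (lt0r_neq0 alpha_gt0)) /eqP.
by rewrite eqr_int => /eqP.
Qed.

End Spectrum.

(** * Triangularity of the Dunkl operators and leading monomials of eigenvectors *)

Section Triangularity.
Variables (C : numClosedFieldType) (N : nat).
Implicit Types (k : expo N) (f : Lpoly C N) (i j l p q : 'I_N).

Definition sqnorm k : int := \sum_i k i ^+ 2.
Definition moment k : int := \sum_(i < N) i%:Z * k i.

(** Used in place of the dominance order. As a lexicographic comparison of two integers it makes any
    two vectors comparable up to ties, so maxima of finite supports exist and anything tied with a
    maximum is a maximum. *)
Definition lower k' k : bool :=
  (sqnorm k' < sqnorm k) || ((sqnorm k' == sqnorm k) && (moment k < moment k')).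

Lemma sum_upd2 (g : 'I_N -> int -> int) k p v q w : p != q ->
  \sum_l g l (upd2 k p v q w l) =
  \sum_l g l (k l) - g p (k p) - g q (k q) + g p v + g q w.
Proof.
move=> neq_pq; have neq_qp : q != p by rewrite eq_sym.
rewrite (bigD1 p) //= (bigD1 q) //= !ffunE eqxx (negPf neq_qp) eqxx.
rewrite [in RHS](bigD1 p) //= [in RHS](bigD1 q) //=.
rewrite (eq_bigr (fun l => g l (k l))); first by move: (\sum_(_ | _) _) => x; ring.
by move=> l /andP[np nq]; rewrite ffunE (negPf np) (negPf nq).
Qed.

Lemma sqnorm_upd2 k p q v : p != q ->
  sqnorm (upd2 k p v q (k q + k p - v)) = sqnorm k + (v - k p) * (v - k q) *+ 2.
Proof. by move=> npq; rewrite /sqnorm (sum_upd2 (fun _ x => x ^+ 2)) //; ring. Qed.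

Lemma moment_upd2 k p q v : p != q ->
  moment (upd2 k p v q (k q + k p - v)) = moment k + (p%:Z - q%:Z) * (v - k p).
Proof. by move=> npq; rewrite /moment (sum_upd2 (fun l x => l%:Z * x)) //; ring. Qed.

(** A value strictly between the two exponents makes [(v - k p) * (v - k q)] negative and lowers the
    norm. The only other case is the swap [v = k q]: the half-open range then forces [k p < k q], so
    the larger exponent moves right and the moment grows. *)
Lemma upd2_lower k p q v : (q < p)%N ->
  Num.min (k q) (k p) < v <= Num.max (k q) (k p) -> v != k p ->
  lower (upd2 k p v q (k q + k p - v)) k.
Proof.
move=> ltqp bounds nvp; have npq : p != q by rewrite neq_ltn ltqp orbT.
rewrite /lower sqnorm_upd2 // moment_upd2 //.
have [eqv|nvq] := eqVneq v (k q).
  rewrite eqv subrr mulr0 mul0rn addr0 eqxx ltxx /= ltrDl mulr_gt0 //; first by lia.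
  by move: bounds nvp; rewrite eqv; lia.
suff -> : sqnorm k + (v - k p) * (v - k q) *+ 2 < sqnorm k by [].
rewrite gtrDl pmulrn_llt0 //; move: bounds nvp nvq; clear; nia.
Qed.

Lemma ddmon_coef p q k k' : (ddmon C p q k)@_k' =
  \sum_(e < `|k q - k p|%N) (if k p < k q then 1 else -1) *
   (upd2 k p (Num.min (k q) (k p) + e%:Z + 1) q
           (k q + k p - (Num.min (k q) (k p) + e%:Z + 1)) == k')%:R.
Proof.
rewrite /ddmon raddf_sum /=; apply: eq_bigr => e _.
by rewrite mcoeffZ zmon_coef.
Qed.

Lemma upd2_id k p q v w : p != q -> (upd2 k p v q w == k) = (v == k p) && (w == k q).
Proof.
move=> npq; apply/eqP/andP => [<-|[/eqP-> /eqP->]].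
  by rewrite !ffunE !eqxx [q == p]eq_sym (negPf npq) eqxx.
by apply/ffunP => l; rewrite ffunE; case: eqP => [->|_] //; case: eqP => [->|].
Qed.

(** The monomial itself corresponds to the value [k p]. The range excludes the minimum and includes
    the maximum, so this value occurs only for [k q < k p], at the last index, where the sign is
    -1. *)
Lemma ddmon_coef_diag p q k : p != q -> (ddmon C p q k)@_k = - (k q < k p)%R%:R.
Proof.
move=> npq; rewrite ddmon_coef.
under eq_bigr => e _ do rewrite upd2_id //.
have [lt_qp|le_pq] := ltP (k q) (k p).
  have ltD : (`|k q - k p|.-1 < `|k q - k p|)%N by lia.
  rewrite (bigD1 (Ordinal ltD)) //= big1 ?addr0 => [|e].
    by rewrite ltNge (ltW lt_qp) /= (_ : _ && _) ?mulr1 //; lia.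
  rewrite -val_eqE /= => ne; have := ltn_ord e => lte.
  by rewrite (_ : _ && _ = false) ?mulr0 //; lia.
rewrite big1 ?oppr0 // => e _; have := ltn_ord e => lte.
by rewrite (_ : _ && _ = false) ?mulr0 //; lia.
Qed.

Lemma ddmon_coef_lower p q k k' :
  (q < p)%N -> k' != k -> (ddmon C p q k)@_k' != 0 -> lower k' k.
Proof.
move=> ltqp nkk'; have npq : p != q by rewrite neq_ltn ltqp orbT.
apply: contraR => nlow; rewrite ddmon_coef big1 // => e _.
case: eqP => [eqk'|_]; last by rewrite mulr0.
case/negP: nlow; rewrite -eqk'; have := ltn_ord e => lte.
apply: upd2_lower => //; first by lia.
apply: contraNneq nkk' => eqv; rewrite -eqk' upd2_id // eqv eqxx /=; lia.
Qed.

Lemma sum_ord_bool (P Q : pred 'I_N) :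
  (\sum_(j | P j) (Q j)%:R : C) = #|[pred j | P j && Q j]|%:R.
Proof.
rewrite -sum1_card natr_sum (bigID Q) /= [X in _ + X]big1 ?addr0.
  by apply: eq_bigr => j /andP[_ ->].
by move=> j /andP[_ /negPf->].
Qed.

Variable alpha : C.

Lemma dunkl_zmon_coef i k k' : (dunkl alpha i (zmon C k))@_k' =
  (alpha * (k i)%:~R - i.+1%:R) * (k == k')%:R
  + \sum_(j : 'I_N | (i < j)%N) (ddmon C j i k)@_k'
  - \sum_(j : 'I_N | (j < i)%N) (ddmon C i j k)@_k'.
Proof.
rewrite /dunkl euler_zmon mcoeffB !mcoeffD mcoeffN !mcoeffZ !(raddf_sum (mcoeff _)).
rewrite zmon_coef mulrA -mulrBl /=.
by congr (_ + _ - _); apply: eq_bigr => j _; rewrite dd_zmon.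
Qed.

Lemma dunkl_coef_diag i k :
  (dunkl alpha i (zmon C k))@_k = dunkl_eigenvalue alpha k i.
Proof.
rewrite dunkl_zmon_coef eqxx mulr1 /dunkl_eigenvalue.
rewrite (eq_bigr (fun j => - (k i < k j)%R%:R)); last first.
  by move=> j ij; rewrite ddmon_coef_diag // neq_ltn ij orbT.
rewrite [X in _ - X](eq_bigr (fun j => - (k j < k i)%R%:R)); last first.
  by move=> j ij; rewrite ddmon_coef_diag // neq_ltn ij orbT.
(* Among the [i.+1] positions up to i, those with exponent at least [k i] belong to the rank; the
   others cancel the diagonal terms from [j < i]. *)
have cardS : i.+1 = (#|[pred j : 'I_N | (j <= i)%N && (k i <= k j)%R]|
                     + #|[pred j : 'I_N | (j < i)%N && (k j < k i)%R]|)%N.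
  rewrite -{1}(card_ord i.+1) -!sum1_card (big_ord_widen N (fun=> 1%N)) //.
  rewrite (bigID (fun j => k i <= k j)) /=; congr (_ + _)%N; apply: eq_bigl => j.
  by rewrite !inE ltnS -ltNge; have [->|] := eqVneq j i; [rewrite ltxx !andbF|
    rewrite -val_eqE /=; lia].
by rewrite !sumrN !sum_ord_bool rankE cardS !natrD; ring.
Qed.

Lemma dunkl_coef_lower i k k' :
  k' != k -> (dunkl alpha i (zmon C k))@_k' != 0 -> lower k' k.
Proof.
move=> nkk'; apply: contraR => nlow.
have dd0 p q : (q < p)%N -> (ddmon C p q k)@_k' = 0.
  by move=> ltqp; apply: contraNeq nlow; apply: ddmon_coef_lower.
rewrite dunkl_zmon_coef [k == k']eq_sym (negPf nkk') mulr0 add0r.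
by rewrite !big1 ?subr0 // => j; apply: dd0.
Qed.

(** Other monomials of [f] contribute only to exponents below them, and [k] is below none of
    them. *)
Lemma dunkl_coef i f k : (forall k', f@_k' != 0 -> ~~ lower k k') ->
  (dunkl alpha i f)@_k = f@_k * dunkl_eigenvalue alpha k i.
Proof.
move=> maxk; rewrite {1}[f]lpolyE linear_sum raddf_sum /=.
have term k' : (dunkl alpha i (f@_k' *: zmon C k'))@_k =
    f@_k' * (dunkl alpha i (zmon C k'))@_k.
  by rewrite -mcoeffZ; congr (mcoeff _ _); apply: linearZ.
rewrite (eq_bigr _ (fun k' _ => term k')).
rewrite -dunkl_coef_diag; case: (msuppP f k) => [k_supp|k_nsupp].
  rewrite (big_fsetD1 k) //= big_seq big1 ?addr0 // => k'.
  rewrite !inE eq_sym => /andP[nkk' sk'].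
  apply/eqP; rewrite mulf_eq0; apply/orP; right.
  by apply: contraNT (maxk k' _); [apply: dunkl_coef_lower|rewrite mcoeff_neq0].
rewrite mul0r big_seq big1 // => k' sk'.
apply/eqP; rewrite mulf_eq0; apply/orP; right.
apply: contraNT (maxk k' _); last by rewrite mcoeff_neq0.
by apply: dunkl_coef_lower; apply: contraNneq k_nsupp => ->.
Qed.

Lemma lower_max (r : seq (expo N)) : r != [::] ->
  exists2 k, k \in r & forall k', k' \in r -> ~~ lower k k'.
Proof.
elim: r => // k0 r IHr _; have [->|/IHr[k kr kmax]] := eqVneq r [::].
  exists k0; first by rewrite inE.
  by move=> k'; rewrite inE => /eqP->; rewrite /lower; lia.
have [lkk0|nlkk0] := boolP (lower k k0).
  exists k0; first by rewrite inE eqxx.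
  move=> k'; rewrite inE => /predU1P[->|/kmax]; first by rewrite /lower; lia.
  by move: lkk0; rewrite /lower; lia.
exists k; first by rewrite inE kr orbT.
by move=> k'; rewrite inE => /predU1P[->|/kmax].
Qed.

Section Eigenvectors.
Hypothesis alpha_gt0 : 0 < alpha.
Local Notation ev := (dunkl_eigenvalue alpha).

Lemma eigen_leading (x : 'I_N -> C) f k :
    (forall i, dunkl alpha i f = x i *: f) -> f@_k != 0 ->
    (forall k', f@_k' != 0 -> ~~ lower k k') ->
  forall i, x i = ev k i.
Proof.
move=> eig fk maxk i; have := dunkl_coef i maxk.
by rewrite eig mcoeffZ mulrC => /(mulfI fk).
Qed.

Lemma eigen_spectrum (x : 'I_N -> C) f :
    (forall i, dunkl alpha i f = x i *: f) -> f != 0 ->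
  exists2 k, f@_k != 0 & forall i, x i = ev k i.
Proof.
move=> eig nzf.
have [|k fk kmax] := @lower_max (msupp f).
  apply: contra nzf => /eqP s0; apply/eqP/malgP => k.
  rewrite mcoeff0; apply/mcoeff_outdom/negP => kf.
  by have : k \in (msupp f : seq _) := kf; rewrite s0.
exists k; first by rewrite mcoeff_neq0.
apply: eigen_leading eig _ _; first by rewrite mcoeff_neq0.
by move=> k'; rewrite mcoeff_neq0; apply: kmax.
Qed.

(** A nonzero [f] would have a monomial carrying the eigenvalues of [k]. Simplicity of the spectrum
    makes that monomial [k] itself, where the coefficient vanishes. *)
Lemma eigen_eq0 f k :
  (forall i, dunkl alpha i f = ev k i *: f) -> f@_k = 0 -> f = 0.
Proof.
move=> eig fk; apply/eqP; apply/negP => /negP /(eigen_spectrum eig)[k' fk'].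
move=> eq_ev; case/eqP: fk'; rewrite -[RHS]fk; congr mcoeff.
rewrite -[RHS]permute_expo1; apply: (eigenvalue_inj alpha_gt0) => i.
by rewrite perm1 eq_ev.
Qed.

(** Every maximal monomial of [f] equals [k], since it carries the same eigenvalues. A monomial not
    below [k] ties with it, hence is maximal too. *)
Lemma eigen_lower f k k' :
    (forall i, dunkl alpha i f = ev k i *: f) -> f@_k' != 0 ->
  k' = k \/ lower k' k.
Proof.
move=> eig fk'.
have leadE (k1 : expo N) :
    f@_k1 != 0 -> (forall k2, f@_k2 != 0 -> ~~ lower k1 k2) -> k1 = k.
  move=> fk1 max1; rewrite -[RHS]permute_expo1; apply: (eigenvalue_inj alpha_gt0).
  by move=> i; rewrite perm1 (eigen_leading eig fk1 max1).
have [|k1 fk1 max1] := @lower_max (msupp f).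
  apply/negP => /eqP s0; move: fk'; rewrite mcoeff_neq0 => kf.
  by have : k' \in (msupp f : seq _) := kf; rewrite s0.
have max_k1 (k2 : expo N) : f@_k2 != 0 -> ~~ lower k1 k2.
  by rewrite mcoeff_neq0; apply: max1.
have k1k : k1 = k by apply: leadE; rewrite ?mcoeff_neq0.
have [?|nlow] := boolP (lower k' k); [by right|left].
apply: leadE (fk') _ => k2 fk2; have := max_k1 k2 fk2; have := max_k1 k' fk'.
by move: nlow; rewrite k1k /lower; lia.
Qed.

End Eigenvectors.
End Triangularity.

(** * Adjacent transpositions on S^m and induction along descents *)

Section AdjacentTransposition.
Variables (N : nat) (i j : 'I_N).
Hypothesis ji : nat_of_ord j = i.+1.
Implicit Types (k : expo N) (s : {perm 'I_N}).
Local Notation t := (tperm i j).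

Lemma adjacent_neq : i != j.
Proof. by rewrite -val_eqE /= ji neq_ltn ltnSn. Qed.

(** Ties are broken by position, but no tie occurs between i and j, and any other position lies on
    the same side of both. *)
Lemma rank_adjacent_neq k l : k i != k j -> rank (permute_expo t k) l = rank k (t l).
Proof.
move=> neq_k; rewrite /rank -!sum1_card [RHS](reindex_inj (@perm_inj _ t)) /=.
apply: eq_bigl => l'; rewrite !inE /precedes !ffunE; congr orb.
move: neq_k; case: (tpermP i j l) => [->|->|/eqP + /eqP +];
case: (tpermP i j l') => [->|->|/eqP + /eqP +]; rewrite -?val_eqE /= ?ji; lia.
Qed.

Lemma rank_adjacent_eq k : k i = k j -> rank k j = (rank k i).+1.
Proof.
move=> eq_k; rewrite /rank (cardD1 j) inE /= precedes_refl add1n; congr _.+1.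
apply: eq_card => l; rewrite !inE /precedes eq_k.
by have [->|] := eqVneq l j; rewrite -?val_eqE /= ji; lia.
Qed.

Lemma permute_adjacent_lower k : k j < k i -> lower (permute_expo t k) k.
Proof.
move=> lt_k; have -> : permute_expo t k = upd2 k j (k i) i (k i + k j - k i).
  apply/ffunP => l; rewrite !ffunE.
  case: tpermP => [->|->|/eqP/negPf -> /eqP/negPf -> //]; rewrite ?eqxx //.
  by rewrite (negPf adjacent_neq); lia.
by apply: upd2_lower; rewrite ?ji //; lia.
Qed.

Lemma inS_adjacent m s : inS m s -> m (s i) != m (s j) -> inS m (t * s)%g.
Proof.
move=> /inSP sS neq_m; apply/inSP => l.
by rewrite -permute_expoM rank_adjacent_neq ?ffunE // -sS permM.
Qed.

Lemma inS_lt m s : inS m s -> m (s j) < m (s i) -> (s i < s j)%N.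
Proof.
move=> /inSP sS lt_m; rewrite -ltnS !sS; apply: precedes_rank.
  by rewrite /precedes !ffunE lt_m.
exact: adjacent_neq.
Qed.

End AdjacentTransposition.

Lemma rank_nonincr N (k : expo N) i : nonincr k -> rank k i = i.+1.
Proof.
move=> k_dec; rewrite /rank -[RHS](card_ord i.+1) -!sum1_card.
rewrite (big_ord_widen N (fun=> 1%N)) //; apply: eq_bigl => j.
rewrite inE /precedes; have := k_dec i j; have := k_dec j i; lia.
Qed.

Lemma nonincr_adjacent N (k : expo N) :
  (forall i j : 'I_N, nat_of_ord j = i.+1 -> k j <= k i) -> nonincr k.
Proof.
move=> k_adj i j le_ij; have := erefl (j - i)%N; move: {2}(j - i)%N => d.
elim: d j le_ij => [|d IHd] j le_ij dij.
  by rewrite (_ : i = j) //; apply: val_inj => /=; lia.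
have ltj : (j.-1 < N)%N by have := ltn_ord j; lia.
have eqj : nat_of_ord j = (Ordinal ltj).+1 by rewrite /=; lia.
by apply: le_trans (k_adj _ _ eqj) (IHd _ _ _) => /=; lia.
Qed.

Lemma inS1 N (m : expo N) : nonincr m -> inS m 1%g.
Proof. by move=> m_dec; apply/inSP => i; rewrite permute_expo1 perm1 rank_nonincr. Qed.

Lemma inS_nonincr N (m : expo N) s : inS m s -> nonincr (permute_expo s m) -> s = 1%g.
Proof.
move=> /inSP sS ms_dec; apply/permP => i; apply: val_inj.
by have := sS i; rewrite rank_nonincr // perm1 => -[].
Qed.

Lemma inS_inj N (m : expo N) s s' : inS m s -> inS m s' ->
  permute_expo s m = permute_expo s' m -> s = s'.
Proof.
move=> /inSP sS /inSP sS' eq_m; apply/permP => i; apply: val_inj.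
by have := sS i; rewrite eq_m -sS' => -[].
Qed.

(** An induction measure in the role of Coxeter length: exchanging adjacent values [s i < s j]
    raises it by [s j - s i]. *)
Definition inS_height N (s : {perm 'I_N}) : nat := \sum_(i < N) i * (N - s i).

Lemma inS_height_adjacent N (m : expo N) s (i j : 'I_N) :
    inS m s -> nat_of_ord j = i.+1 -> m (s j) < m (s i) ->
  (inS_height s < inS_height (tperm i j * s)%g)%N.
Proof.
move=> sS ji lt_m; have lt_s := inS_lt ji sS lt_m.
have neq_ji : j != i by rewrite eq_sym adjacent_neq.
rewrite /inS_height [ltnLHS](bigD1 i) // [ltnRHS](bigD1 i) //=.
rewrite [in ltnLHS](bigD1 j) // [in ltnRHS](bigD1 j) //= !permM tpermL tpermR.
rewrite [X in (_ < _ + (_ + X))%N](eq_bigr (fun l : 'I_N => l * (N - s l)))%N.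
  by have := ltn_ord (s j); rewrite ji; move: (\sum_(_ | _) _)%N => S; nia.
by move=> l /andP[ni nj]; rewrite permM tpermD // eq_sym.
Qed.

(* S^m is reached from the identity through descents; the induction hypothesis
   is available on everything not higher than s, as the Yang-Baxter argument
   looks two steps down. *)
Lemma inS_ind N (m : expo N) (P : {perm 'I_N} -> Prop) :
    P 1%g ->
    (forall s (i j : 'I_N), inS m s -> nat_of_ord j = i.+1 -> m (s j) < m (s i) ->
       (forall s', inS m s' -> (inS_height s' <= inS_height s)%N -> P s') ->
       P (tperm i j * s)%g) ->
  forall s, inS m s -> P s.
Proof.
move=> P1 Pstep s; have [d] := ubnP (inS_height s).
elim: d s => // d IHd s; rewrite ltnS => hs sS.
have [/forallP ms_dec|] := boolP [forall i : 'I_N, forall j : 'I_N,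
    (nat_of_ord j == i.+1) ==> (m (s j) <= m (s i))].
  rewrite (inS_nonincr sS) //; apply: nonincr_adjacent => i j ji.
  by have /forallP/(_ j) := ms_dec i; rewrite ji eqxx !ffunE.
(* An ascent of the rearranged vector exhibits [s] as one step above [tperm i j * s], which has
   smaller height. *)
case/forallPn => i /forallPn[j]; rewrite negb_imply -ltNge => /andP[/eqP ji lt_m].
have neq_m : m (s i) != m (s j) by rewrite lt_eqF.
have tsS := inS_adjacent ji sS neq_m.
have lt_tm : m ((tperm i j * s)%g j) < m ((tperm i j * s)%g i).
  by rewrite !permM tpermL tpermR.
have sE : s = (tperm i j * (tperm i j * s))%g by rewrite mulgA tperm2 mul1g.
have := inS_height_adjacent tsS ji lt_tm; rewrite -sE => lt_h.
rewrite sE; apply: Pstep tsS ji lt_tm _ => s' sS' hs'; apply: IHd => //.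
by apply: leq_ltn_trans hs' (leq_trans lt_h hs).
Qed.

(* K^2 = 1 turns the action on the lower of two neighbouring eigenvectors
   into the action on the upper one. *)
Lemma involutive_pair (R : fieldType) (V : lmodType R) (K : {linear V -> V}) c
    (f g : V) : involutive K -> K g = f - c *: g -> K f = c *: f + (1 - c ^+ 2) *: g.
Proof.
move=> KK Kg; have KZ a h : K (a *: h) = a *: K h by apply: linearZ.
have := congr1 K Kg; rewrite KK linearB KZ Kg => /esym/(canRL (subrK _)) ->.
rewrite scalerBl scale1r scalerBr scalerA -expr2.
by rewrite addrC -addrA [X in _ + X]addrC.
Qed.

(** * Adjacent transpositions acting on nonsymmetric Jack polynomials *)

Section NonsymmetricJack.
Variables (C : numClosedFieldType) (N : nat) (alpha : C).
Hypothesis alpha_gt0 : 0 < alpha.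
Variables (m : expo N) (Phi : {perm 'I_N} -> Lpoly C N).
Hypothesis PhiP : PhiSpec alpha m Phi.
Implicit Types (s : {perm 'I_N}) (k : expo N) (f : Lpoly C N).

Lemma Phi_eigen s : inS m s -> forall l,
  dunkl alpha l (Phi s) = dunkl_eigenvalue alpha (permute_expo s m) l *: Phi s.
Proof. by move=> sS l; rewrite -xiE // (PhiP sS).1. Qed.

Lemma Phi_coef s : inS m s -> (Phi s)@_(permute_expo s m) = 1.
Proof. by move=> sS; exact: (PhiP sS).2. Qed.

Lemma Phi_lower s k : inS m s -> (Phi s)@_k != 0 ->
  k = permute_expo s m \/ lower k (permute_expo s m).
Proof. by move=> sS; exact: (eigen_lower alpha_gt0 (Phi_eigen sS)). Qed.

Lemma lower_irr k : lower k k = false.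
Proof. by rewrite /lower; lia. Qed.

(** Among the terms with nonzero coefficient, one with maximal leading exponent has a leading
    monomial that no other term contains, because leading exponents are distinct on S^m. *)
Lemma Phi_free (c : {perm 'I_N} -> C) :
  \sum_(s | inS m s) c s *: Phi s = 0 -> forall s, inS m s -> c s = 0.
Proof.
move=> sum0 s0 s0S; apply/eqP; apply/negP => /negP c0.
pose r := [seq permute_expo s m | s <- enum {perm 'I_N} & inS m s && (c s != 0)].
have rP s : inS m s -> c s != 0 -> permute_expo s m \in r.
  by move=> sS cs; apply: map_f; rewrite mem_filter sS cs mem_enum.
have [|k kr kmax] := @lower_max N r.
  by apply: contraTneq (rP _ s0S c0) => ->.
have {kr} [s sS [cs eqk]] : exists2 s, inS m s & c s != 0 /\ k = permute_expo s m.
  by case/mapP: kr => s; rewrite mem_filter => /andP[/andP[sS cs] _] ->; exists s.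
have := congr1 (mcoeff k) sum0; rewrite mcoeff0 (raddf_sum (mcoeff k)) (bigD1 s) //=.
rewrite big1 => [|s' /andP[s'S ns]].
  by rewrite addr0 mcoeffZ eqk Phi_coef // mulr1 => /eqP; rewrite (negPf cs).
rewrite mcoeffZ; have [->|cs'] := eqVneq (c s') 0; first by rewrite mul0r.
suff -> : (Phi s')@_k = 0 by rewrite mulr0.
apply/eqP; apply/negP => /negP /(Phi_lower s'S)[eqk'|low_k].
  by case/eqP: ns; apply: (inS_inj s'S sS); rewrite -eqk'.
by have := kmax _ (rP _ s'S cs'); rewrite low_k.
Qed.

Lemma Kpoly_tperm_coef i j f k :
  (Kpoly (tperm i j) f)@_k = f@_(permute_expo (tperm i j) k).
Proof.
have invol : involutive (permute_expo (tperm i j)).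
  by move=> k'; rewrite permute_expoM tperm2 permute_expo1.
rewrite [f in LHS]lpolyE [f in RHS]lpolyE linear_sum !(raddf_sum (mcoeff _)) /=.
apply: eq_bigr => k' _.
have -> : Kpoly (tperm i j) (f@_k' *: zmon C k') =
    f@_k' *: Kpoly (tperm i j) (zmon C k').
  exact: linearZ.
by rewrite !mcoeffZ Kpoly_zmon !zmon_coef -(inj_eq (inv_inj invol) k') invol.
Qed.

Section Adjacent.
Variables (i j : 'I_N).
Hypothesis ji : nat_of_ord j = i.+1.
Local Notation t := (tperm i j).
Local Notation ev := (dunkl_eigenvalue alpha).

Lemma eigenvalue_adjacent_eq k : k i = k j -> ev k i - ev k j = 1.
Proof.
by move=> eqk; rewrite /dunkl_eigenvalue (rank_adjacent_eq ji eqk) eqk -natr1; ring.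
Qed.

Lemma eigenvalue_adjacent_neq k l : k i != k j -> ev (permute_expo t k) l = ev k (t l).
Proof. by move=> neqk; rewrite /dunkl_eigenvalue rank_adjacent_neq // ffunE. Qed.

Lemma eigenvalue_neq k l l' : l != l' -> ev k l - ev k l' != 0.
Proof.
apply: contraNneq => /eqP; rewrite subr_eq0 => /eqP eq_ev; apply/eqP.
by apply: (@precedes_anti _ k); rewrite -(eigenvalue_le alpha_gt0) eq_ev lexx.
Qed.

(** The eigenvalue gap is 1, so the shifted eigenvector is [K Phi - Phi], with the two eigenvalues
    exchanged. If it were nonzero, the exponent carrying them would be [k] transposed, that is [k],
    whose eigenvalues at i and j differ. *)
Lemma Kpoly_Phi_eq s : inS m s -> m (s i) = m (s j) -> Kpoly t (Phi s) = Phi s.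
Proof.
move=> sS eq_m; set k := permute_expo s m.
have eqk : k i = k j by rewrite !ffunE.
have ev_ij := eigenvalue_adjacent_eq eqk.
have ev_ji : ev k j - ev k i = -1 by rewrite -opprB ev_ij.
have nz : ev k j - ev k i != 0 by rewrite ev_ji oppr_eq0 oner_eq0.
have := dunkl_eigen_shift ji (Phi_eigen sS) nz; rewrite -/k ev_ji invrN1 scaleN1r /=.
move=> eig; apply/eqP; rewrite -subr_eq0; apply/negP => /negP nz_g.
have [k' _ ev_k'] := eigen_spectrum eig nz_g.
have k'k : k' = k.
  rewrite (eigenvalue_inj alpha_gt0 (fun l => esym (ev_k' l))).
  by apply/ffunP => l; rewrite ffunE; case: tpermP => [->|->|].
by have := ev_k' i; rewrite k'k tpermL => /eqP; rewrite -subr_eq0 (negPf nz).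
Qed.

(** The vector obtained by shifting [Phi (t * s)] has the eigenvalues of [Phi s]. Both have
    coefficient 1 at the leading monomial of [Phi s], which is too high to occur in [Phi (t * s)];
    hence their difference vanishes. *)
Lemma Kpoly_Phi_lower s : inS m s -> m (s j) < m (s i) ->
  Kpoly t (Phi (t * s)%g) =
  Phi s - (xi alpha m s i - xi alpha m s j)^-1 *: Phi (t * s)%g.
Proof.
move=> sS lt_m; have neq_m : m (s i) != m (s j) by rewrite gt_eqF.
have tsS := inS_adjacent ji sS neq_m.
set k := permute_expo s m; set k' := permute_expo (t * s)%g m.
have k'E : k' = permute_expo t k by rewrite permute_expoM.
have neqk : k i != k j by rewrite !ffunE.
have ev_k' l : ev k' l = ev k (t l) by rewrite k'E eigenvalue_adjacent_neq.
have nz : ev k' j - ev k' i != 0 by apply: eigenvalue_neq; rewrite eq_sym adjacent_neq.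
have := dunkl_eigen_shift ji (Phi_eigen tsS) nz.
rewrite -/k' !ev_k' tpermL tpermR !xiE // -/k.
set c := (_ - _)^-1; set g := _ + _ => eig /=.
suff : g - Phi s = 0 by move/eqP; rewrite subr_eq0 => /eqP <-; rewrite /g addrK.
have low_k' : lower k' k by rewrite k'E permute_adjacent_lower // !ffunE.
apply: (@eigen_eq0 _ _ _ alpha_gt0 _ k) => [l|].
  have -> : dunkl alpha l (g - Phi s) = dunkl alpha l g - dunkl alpha l (Phi s).
    exact: linearB.
  by rewrite eig ev_k' tpermK Phi_eigen // scalerBr.
rewrite mcoeffB mcoeffD mcoeffZ Kpoly_tperm_coef -k'E !Phi_coef //.
suff -> : (Phi (t * s)%g)@_k = 0 by rewrite mulr0 addr0 subrr.
apply/eqP; apply/negP => /negP /(Phi_lower tsS); rewrite -/k' => -[kk'|].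
  by move: low_k'; rewrite kk' lower_irr.
by move: low_k'; rewrite /lower; lia.
Qed.

(** Entries of the two by two matrix of K on the span of [Phi s] and [Phi (t * s)]. Monic
    normalisation makes [Koff] asymmetric: it is 1 in one direction only. *)
Definition Kdiag s : C := (xi alpha m s i - xi alpha m s j)^-1.
Definition Koff s : C :=
  if m (s i) < m (s j) then 1 else 1 - Kdiag s ^+ 2.

Lemma Kpoly_Phi_neq s : inS m s -> m (s i) != m (s j) ->
  Kpoly t (Phi s) = Kdiag s *: Phi s + Koff s *: Phi (t * s)%g.
Proof.
move=> sS neq_m; have tsS := inS_adjacent ji sS neq_m.
rewrite /Koff /Kdiag; have [lt_m|gt_m|eq_m] := ltgtP (m (s i)) (m (s j)).
- have lt_tm : m ((t * s)%g j) < m ((t * s)%g i) by rewrite !permM tpermL tpermR.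
  have := Kpoly_Phi_lower tsS lt_tm; rewrite mulgA tperm2 mul1g => ->.
  have -> : xi alpha m (t * s)%g i = xi alpha m s j by rewrite /xi permM tpermL.
  have -> : xi alpha m (t * s)%g j = xi alpha m s i by rewrite /xi permM tpermR.
  by rewrite scale1r -[xi _ _ _ i - _]opprB invrN scaleNr addrC.
- apply: (involutive_pair (K := Kpoly t)); first exact: Kpoly_tpermK.
  exact: Kpoly_Phi_lower.
- by rewrite eq_m eqxx in neq_m.
Qed.

Lemma xi_adjacent_eq s : inS m s -> m (s i) = m (s j) ->
  xi alpha m s i - xi alpha m s j = 1.
Proof. by move=> sS eq_m; rewrite !xiE // eigenvalue_adjacent_eq // !ffunE. Qed.

End Adjacent.
End NonsymmetricJack.

(** * Operators on tensor factors and the R-matrix *)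

Section TensorOperators.
Variables (C : numClosedFieldType) (N n : nat) (X : lmodType C).
Local Notation tens := (tens N n X).
Implicit Types (h : tens) (s : {perm 'I_N}) (i j l : 'I_N) (a b c d : 'I_n).

Lemma Pperm_is_linear s : linear (@Pperm C N n X s).
Proof. by move=> c h h'; apply/ffunP => eta; rewrite !ffunE. Qed.
HB.instance Definition _ s :=
  GRing.isLinear.Build C tens tens *:%R (@Pperm C N n X s) (Pperm_is_linear s).

Lemma Eu_is_linear i c d : linear (@Eu C N n X i c d).
Proof.
move=> z h h'; apply/ffunP => eta; rewrite !ffunE.
by case: ifP; rewrite ?scaler0 ?addr0.
Qed.
HB.instance Definition _ i c d :=
  GRing.isLinear.Build C tens tens *:%R (@Eu C N n X i c d) (Eu_is_linear i c d).

Lemma PpermM s s' h : Pperm s (Pperm s' h) = Pperm (s * s')%g h.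
Proof.
apply/ffunP => eta; rewrite !ffunE; congr (h _); apply/ffunP => k.
by rewrite !ffunE invMg permM.
Qed.

Lemma Pperm1 h : Pperm 1%g h = h.
Proof.
apply/ffunP => eta; rewrite ffunE; congr (h _); apply/ffunP => k.
by rewrite ffunE invg1 perm1.
Qed.

Lemma Pperm_tpermK i j : involutive (@Pperm C N n X (tperm i j)).
Proof. by move=> h; rewrite PpermM tperm2 Pperm1. Qed.

Lemma tperm_braid i j l : i != l -> j != l -> i != j ->
  (tperm i j * tperm j l * tperm i j)%g = (tperm j l * tperm i j * tperm j l)%g.
Proof.
move=> nil njl nij.
have conj x y u v : (tperm x y * tperm u v * tperm x y)%g =
    tperm (tperm x y u) (tperm x y v).
  by rewrite -tpermJ /conjg tpermV mulgA.
by rewrite !conj tpermR tpermL (tpermD nil njl) [tperm j l i]tpermD // eq_sym.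
Qed.

Lemma Pperm_Eu i j l c d h : let t := tperm i j in
  Pperm t (Eu l c d h) = Eu (t l) c d (Pperm t h).
Proof.
move=> t; apply/ffunP => eta; rewrite !ffunE /= tpermV; case: ifP => // _.
congr (h _); apply/ffunP => k; rewrite !ffunE.
by rewrite (inj_eq (@perm_inj _ t)).
Qed.

(* P_{0,i} P_{0,j} = P_{i,j} P_{0,i}, entry (a, b) *)
Lemma sum_Eu_Eu i j a b h : i != j ->
  \sum_c Eu i c a (Eu j b c h) = Pperm (tperm i j) (Eu i b a h).
Proof.
move=> nij; apply/ffunP => eta; rewrite sum_ffunE !ffunE tpermV tpermL.
rewrite (bigD1 (eta i)) //= big1 ?addr0 => [|c nc]; last first.
  by rewrite ffunE eq_sym (negPf nc).
rewrite !ffunE eqxx [j == i]eq_sym (negPf nij); case: ifP => // /eqP eb.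
congr (h _); apply/ffunP => k; rewrite !ffunE.
have [->|nkj] := eqVneq k j; first by rewrite tpermR [j == i]eq_sym (negPf nij).
by have [//|nki] := eqVneq k i; rewrite tpermD // eq_sym.
Qed.

End TensorOperators.

Section Rcheck.
Variables (C : numClosedFieldType) (N n : nat).
Implicit Types (v w : Vsp C N n) (i j l : 'I_N) (x y : C).

Lemma Rcheck_is_linear i j x : linear (@Rcheck C N n i j x).
Proof.
move=> c v w; rewrite /Rcheck (linearP (@Pperm C N n _ _)).
rewrite !scalerDr !scalerA [_^-1 * _]mulrC.
by rewrite addrACA.
Qed.
HB.instance Definition _ i j x :=
  GRing.isLinear.Build C (Vsp C N n) (Vsp C N n) *:%R (@Rcheck C N n i j x)
    (Rcheck_is_linear i j x).

End Rcheck.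

(* The Yang-Baxter equation for u^-1 + P with one of the three spectral
   parameters equal to 1: the antisymmetric vectors of B are sent to the
   antisymmetric vectors of A. *)
Lemma yang_baxter_antisym (R : fieldType) (V : lmodType R) (A B : {linear V -> V})
    (x : R) (v : V) :
    involutive A -> involutive B -> (forall u, A (B (A u)) = B (A (B u))) ->
    x != 0 -> x + 1 != 0 -> B v = - v ->
  let y := (x + 1)^-1 *: (x^-1 *: v + A v) + B (x^-1 *: v + A v) in A y = - y.
Proof.
move=> AA BB ABA nx nx1 Bv.
have AZ c u : A (c *: u) = c *: A u by apply: linearZ.
have BZ c u : B (c *: u) = c *: B u by apply: linearZ.
have AN u : A (- u) = - A u by apply: linearN.
have BN u : B (- u) = - B u by apply: linearN.
have AD u w : A (u + w) = A u + A w by apply: linearD.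
have BD u w : B (u + w) = B u + B w by apply: linearD.
(* This partial fraction identity is the only relation between the two spectral parameters that the
   cancellation needs. *)
have eqc : x^-1 = (x + 1)^-1 + (x + 1)^-1 * x^-1 by field; rewrite nx nx1.
move: (x + 1)^-1 (x^-1) eqc => c a eqc.
have aE u : a *: u = c *: u + c *: (a *: u) by rewrite {1}eqc scalerDl scalerA.
rewrite /= !(AD, BD, AZ, BZ) ABA !(Bv, AN, BN, AZ, BZ) AA !scalerN.
rewrite [in - (a *: A v)]aE !scalerDr !opprD !opprK.
move: (A v) (B (A v)) => Av BAv.
rewrite [X in _ = _ + (X - _)](aE V v) !addrA.
rewrite [LHS](ACl (1*4*2*3*5)) /= subrr add0r.
by rewrite [RHS](ACl (1*4*3*2*5)) /= addNr add0r.
Qed.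

(** * Operator-valued series and the Yang-Baxter equation *)

Section Series.
Variables (C : numClosedFieldType) (N n : nat).

(** Source and target may differ, so that one set of lemmas serves both for [Rcheck] and for the
    maps [ptens p]. *)
Definition intertwines (X Y : lmodType C) (f : tens N n X -> tens N n Y)
    (A : series N n X) (B : series N n Y) : Prop :=
  forall a b r h, f (A a b r h) = B a b r (f h).

Lemma intertwines_smul (X Y : lmodType C) (f : {linear tens N n X -> tens N n Y})
    A A' B B' :
  intertwines f A A' -> intertwines f B B' ->
  intertwines f (smul A B) (smul A' B').
Proof.
move=> fA fB a b r h; rewrite /smul linear_sum; apply: eq_bigr => c _.
by rewrite linear_sum; apply: eq_bigr => p _; rewrite fA fB.
Qed.

Lemma intertwines_one (X Y : lmodType C) (f : {linear tens N n X -> tens N n Y}) :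
  intertwines f (@sone C N n X) (@sone C N n Y).
Proof. by move=> a b r h; rewrite /sone; case: ifP; rewrite ?linear0. Qed.

Lemma intertwines_factor (X Y : lmodType C) (f : {linear tens N n X -> tens N n Y})
    i i' D D' :
  (forall c d h, f (Eu i c d h) = Eu i' c d (f h)) ->
  (forall h, f (D h) = D' (f h)) ->
  intertwines f (factor i D) (factor i' D').
Proof.
move=> fE fD a b [|r] h /=; first by case: ifP; rewrite ?linear0.
by rewrite fE; congr Eu; elim: r => //= r <-; rewrite linearN fD.
Qed.

Lemma sum_triangle (V : zmodType) (F : nat -> nat -> V) r :
  \sum_(p < r.+1) \sum_(q < (r - p).+1) F p q =
  \sum_(t < r.+1) \sum_(p < t.+1) F p (t - p)%N.
Proof.
elim: r => [|r IHr]; first by rewrite !big_ord1.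
rewrite [RHS]big_ord_recr -IHr [LHS]big_ord_recr /= subnn big_ord1 /=.
rewrite [X in _ = _ + X]big_ord_recr /= subnn addrA; congr (_ + _).
rewrite -big_split /=; apply: eq_bigr => p _.
by have ltp := ltn_ord p; rewrite big_ord_recr /= subSn.
Qed.

Definition additive_series (X : lmodType C) (A : series N n X) : Prop :=
  forall a b r (c : C) h h', A a b r (c *: h + h') = c *: A a b r h + A a b r h'.

Section AdditiveSeries.
Variables (X : lmodType C) (A : series N n X).
Hypothesis A_lin : additive_series A.

Lemma series_sum a b r (I : Type) (s : seq I) (P : pred I) (F : I -> tens N n X) :
  A a b r (\sum_(i <- s | P i) F i) = \sum_(i <- s | P i) A a b r (F i).
Proof.
have A0 : A a b r 0 = 0.
  by have := A_lin a b r (-1) 0 0; rewrite scaleN1r oppr0 addr0 scaleN1r addNr.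
apply: (big_morph (A a b r) _ A0) => h h'.
by have := A_lin a b r 1 h h'; rewrite !scale1r.
Qed.

Lemma seriesN a b r h : A a b r (- h) = - A a b r h.
Proof.
have A0 : A a b r 0 = 0 by have := series_sum a b r [::] xpredT id; rewrite !big_nil.
by have := A_lin a b r (-1) h 0; rewrite !scaleN1r !addr0 A0 addr0.
Qed.

End AdditiveSeries.

Lemma additive_smul (X : lmodType C) (A B : series N n X) :
  additive_series A -> additive_series B -> additive_series (smul A B).
Proof.
move=> A_lin B_lin a b r c h h'; rewrite /smul scaler_sumr -big_split.
apply: eq_bigr => d _; rewrite scaler_sumr -big_split.
by apply: eq_bigr => p _; rewrite /= B_lin A_lin.
Qed.

Lemma additive_factor (X : lmodType C) i (D : tens N n X -> tens N n X) :
  (forall c h h', D (c *: h + h') = c *: D h + D h') ->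
  additive_series (factor i D).
Proof.
move=> D_lin a b [|r] c h h' /=; first by case: ifP; rewrite ?scaler0 ?addr0.
have -> : iter r (fun x => - D x) (c *: h + h') =
    c *: iter r (fun x => - D x) h + iter r (fun x => - D x) h'.
  by elim: r => //= r ->; rewrite D_lin opprD scalerN.
exact: linearP.
Qed.

Lemma additive_one (X : lmodType C) : additive_series (@sone C N n X).
Proof. by move=> a b r c h h'; rewrite /sone; case: ifP; rewrite ?scaler0 ?addr0. Qed.

Lemma additive_foldr (X : lmodType C) (D : 'I_N -> tens N n X -> tens N n X) s :
  (forall i c h h', D i (c *: h + h') = c *: D i h + D i h') ->
  additive_series
    (foldr (@smul C N n X) (@sone C N n X) [seq factor i (D i) | i <- s]).
Proof.
move=> D_lin; elim: s => [|i s IHs]; first exact: additive_one.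
by apply: additive_smul IHs; apply: additive_factor.
Qed.

(** Needed to isolate two consecutive factors in the right-nested product [Tser]. *)
Lemma smulA (X : lmodType C) (A B D : series N n X) a b r h : additive_series A ->
  smul A (smul B D) a b r h = smul (smul A B) D a b r h.
Proof.
move=> A_lin; rewrite /smul.
transitivity (\sum_(c < n) \sum_(d < n) \sum_(p < r.+1) \sum_(q < (r - p).+1)
    A a c p (B c d q (D d b (r - (p + q))%N h))).
  apply: eq_bigr => c _; rewrite exchange_big /=; apply: eq_bigr => p _.
  rewrite (series_sum A_lin); apply: eq_bigr => d _.
  by rewrite (series_sum A_lin); apply: eq_bigr => q _; rewrite subnDA.
rewrite exchange_big; apply: eq_bigr => d _ /=.
rewrite [RHS]exchange_big /=; apply: eq_bigr => c _.
rewrite (sum_triangle (fun p q => A a c p (B c d q (D d b (r - (p + q))%N h)))).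
apply: eq_bigr => t _; apply: eq_bigr => p _.
by rewrite subnKC // -ltnS.
Qed.

Local Notation Vs := (Vsp C N n).
Local Notation scalar_factor x i := (factor i (fun v : Vs => x *: v)).

Lemma scalar_factorS (x : C) i a b r (h : Vs) :
  scalar_factor x i a b r.+1 h = (- x) ^+ r *: Eu i b a h.
Proof.
have -> : (- x) ^+ r *: Eu i b a h = Eu i b a ((- x) ^+ r *: h).
  by apply: esym; exact: linearZ.
congr (Eu _ _ _ _); elim: r => [|r IHr]; first by rewrite expr0 scale1r.
by rewrite /= IHr scalerA exprS mulNr scaleNr.
Qed.

(** The last sum is the Cauchy product of the two geometric series, multiplied by
    [P_(0,i) P_(0,j) = P_(i,j) P_(0,i)]. It is empty for [r' = 0], so the truncated predecessor does
    no harm. *)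
Lemma smul_factor (x y : C) i j a b r (h : Vs) : i != j ->
  smul (scalar_factor x i) (scalar_factor y j) a b r h =
  if r is r'.+1 then
    (- x) ^+ r' *: Eu i b a h + (- y) ^+ r' *: Eu j b a h
    + (\sum_(p < r') (- x) ^+ p * (- y) ^+ (r'.-1 - p))
      *: Pperm (tperm i j) (Eu i b a h)
  else if a == b then h else 0.
Proof.
move=> nij; case: r => [|r].
  rewrite /smul (eq_bigr _ (fun c _ => big_ord1 _ _)) /= (bigD1 a) //= eqxx.
  by rewrite big1 ?addr0 // => c nca; rewrite eq_sym (negPf nca).
set A := factor i _; set B := factor j _.
have split_sum c : \sum_(p < r.+2) A a c p (B c b (r.+1 - p)%N h) =
    A a c r.+1 (B c b 0%N h) + A a c 0%N (B c b r.+1 h)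
    + \sum_(p < r) A a c p.+1 (B c b (r - p)%N h).
  by rewrite big_ord_recl big_ord_recr /= subnn [LHS]addrC -addrA [LHS]addrC.
rewrite /smul (eq_bigr _ (fun c _ => split_sum c)) !big_split /=.
congr (_ + _ + _).
- rewrite (bigD1 b) //= eqxx big1 ?addr0 => [|c ncb]; first exact: scalar_factorS.
  by rewrite (negPf ncb) -[LHS]/(A a c r.+1 0) /A scalar_factorS linear0 scaler0.
- rewrite (bigD1 a) //= eqxx big1 ?addr0 => [|c nca]; first exact: scalar_factorS.
  by rewrite eq_sym (negPf nca).
rewrite exchange_big scaler_suml; apply: eq_bigr => p _.
have ltp := ltn_ord p; have -> : (r - p = (r.-1 - p).+1)%N by lia.
rewrite -(sum_Eu_Eu _ _ _ nij) scaler_sumr; apply: eq_bigr => c _.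
rewrite -[LHS]/(A a c p.+1 (B c b (r.-1 - p).+1 h)) /A /B !scalar_factorS.
by rewrite -scalerA; congr (_ *: _); apply: linearZ.
Qed.

(** One coefficient of the Yang-Baxter equation: [P] is [P_(i,j)], [Q] a matrix unit at i, [P Q P]
    the same at j, [c = 1 / (x - y)], and [p0], [q0] are powers of [- x] and [- y]. The third
    coefficient of [A] is symmetric in the two parameters, hence the same on both sides. *)
Lemma yang_baxter_algebra (V : lmodType C) (P Q : {linear V -> V}) (c p0 q0 : C) h :
    involutive P ->
  let A p q h := p *: Q h + q *: P (Q (P h)) + (c * (q0 - p0)) *: P (Q h) in
  c *: A p0 q0 h + P (A p0 q0 h) = A q0 p0 (c *: h + P h).
Proof.
move=> PP A; rewrite /A.
have PD u v : P (u + v) = P u + P v by apply: linearD.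
have QD u v : Q (u + v) = Q u + Q v by apply: linearD.
have PZ a u : P (a *: u) = a *: P u by apply: linearZ.
have QZ a u : Q (a *: u) = a *: Q u by apply: linearZ.
rewrite !(PD, PZ, QD, QZ, PP) !scalerDr !scalerA.
move: (Q h) (P (Q h)) (Q (P h)) (P (Q (P h))) => u1 u2 u3 u4.
have diffE u : (c * (q0 - p0)) *: u = (q0 * c) *: u - (p0 * c) *: u.
  by rewrite -scalerBl -mulrBl mulrC.
rewrite (mulrC c (c * _)) !diffE (mulrC c p0) (mulrC c q0) !addrA.
rewrite [LHS](ACl (1*7*6*5*4*3*2)) /= subrr add0r.
by rewrite [RHS](ACl (3*7*1*2*4*5*6)) /= subrr add0r.
Qed.

Lemma yang_baxter_pair (x y : C) i j : i != j -> x != y ->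
  intertwines (Rcheck i j (x - y) : Vs -> Vs)
    (smul (scalar_factor x i) (scalar_factor y j))
    (smul (scalar_factor y i) (scalar_factor x j)).
Proof.
move=> nij nxy a b r h; rewrite !smul_factor //.
case: r => [|r]; first by case: ifP; rewrite ?linear0.
have nz : x - y != 0 by rewrite subr_eq0.
(* Summing the Cauchy product gives a divided difference of powers; its denominator is the one in
   [Rcheck], which is what makes the coefficients match. *)
have geomE (u v : C) : u - v != 0 ->
    \sum_(p < r) (- u) ^+ p * (- v) ^+ (r.-1 - p) =
    (u - v)^-1 * ((- v) ^+ r - (- u) ^+ r).
  move=> nuv; rewrite (subrXX (- v) (- u) r) opprK [- v + u]addrC mulKf //.
  by apply: eq_bigr => p _; rewrite mulrC.
rewrite !geomE //; last by rewrite -opprB oppr_eq0.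
have -> : (y - x)^-1 * ((- x) ^+ r - (- y) ^+ r) =
    (x - y)^-1 * ((- y) ^+ r - (- x) ^+ r).
  by rewrite -(opprB x y) invrN -(opprB ((- y) ^+ r)) mulrNN.
have EuE (v : Vs) : Eu j b a v =
    Pperm (tperm i j) (Eu i b a (Pperm (tperm i j) v)).
  by rewrite Pperm_Eu tpermL Pperm_tpermK.
rewrite !EuE /Rcheck; apply: (@yang_baxter_algebra _ (Pperm (tperm i j)) (Eu i b a)).
exact: Pperm_tpermK.
Qed.

(** Places the factors at i and j next to each other in the ordered product. *)
Lemma enum_adjacent (i j : 'I_N) : nat_of_ord j = i.+1 ->
  exists s1 s2, [/\ enum 'I_N = s1 ++ [:: i, j & s2],
    i \notin s1 ++ s2 & j \notin s1 ++ s2].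
Proof.
move=> ji; exists (take i (enum 'I_N)), (drop i.+2 (enum 'I_N)).
have eqE : enum 'I_N = take i (enum 'I_N) ++ [:: i, j & drop i.+2 (enum 'I_N)].
  rewrite -{1}(cat_take_drop i (enum 'I_N)); congr (_ ++ _).
  have ltj := ltn_ord j; rewrite (drop_nth i) ?size_enum_ord //.
  rewrite nth_ord_enum; congr (_ :: _); rewrite (drop_nth i) ?size_enum_ord -?ji //.
  by rewrite nth_ord_enum.
have := enum_uniq 'I_N; rewrite {1}eqE; move: eqE.
move: (take _ _) (drop _ _) => s1 s2 eqE.
rewrite cat_uniq /= !inE !negb_or => /and3P[_ /and3P[ni1 nj1 _]].
by case/and3P=> /andP[_ ni2] nj2 _; rewrite !mem_cat !negb_or ni1 nj1 ni2 nj2.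
Qed.

Definition scalar_Tser (x : 'I_N -> C) : series N n C^o :=
  Tser (fun i (v : Vs) => x i *: v).

Lemma scalar_Tser_additive x : additive_series (scalar_Tser x).
Proof.
by apply: additive_foldr => i c h h'; rewrite scalerDr !scalerA mulrC.
Qed.

(** [Rcheck] commutes with the factors at all other sites, whose parameters the transposition fixes;
    on the consecutive factors at i and j it is the Yang-Baxter equation. *)
Lemma Rcheck_scalar_Tser (x : 'I_N -> C) (i j : 'I_N) :
    nat_of_ord j = i.+1 -> x i != x j ->
  intertwines (Rcheck i j (x i - x j) : Vs -> Vs)
    (scalar_Tser x) (scalar_Tser (x \o tperm i j)).
Proof.
move=> ji nx; have nij := adjacent_neq ji.
pose f := Rcheck i j (x i - x j) : {linear Vs -> Vs}.
have [s1 [s2 [enumE ni nj]]] := enum_adjacent ji.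
pose T y s := foldr (@smul C N n C^o) (@sone C N n C^o)
  [seq factor l (fun v : Vs => y l *: v) | l <- s].
have T_factor l : l != i -> l != j ->
    intertwines f (factor l (fun v : Vs => x l *: v))
      (factor l (fun v : Vs => (x \o tperm i j) l *: v)).
  move=> nli nlj; apply: intertwines_factor => [c d h|h]; last first.
    by rewrite /= tpermD 1?eq_sym //; apply: linearZ.
  have := Pperm_Eu i j l c d h; rewrite /= tpermD 1?eq_sym // => PE.
  rewrite /f /= /Rcheck PE [RHS]linearD; congr (_ + _).
  by apply: esym; apply: linearZ.
have T2 : intertwines f (T x s2) (T (x \o tperm i j) s2).
  move: ni nj; rewrite !mem_cat !negb_or => /andP[_ +] /andP[_ +].
  elim: (s2) => [|l s IHs]; first by move=> _ _; exact: intertwines_one.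
  rewrite !inE !negb_or ![_ == l]eq_sym => /andP[nli nis] /andP[nlj njs].
  by apply: intertwines_smul; [exact: T_factor|exact: IHs].
have Tij : intertwines f (T x [:: i, j & s2]) (T (x \o tperm i j) [:: i, j & s2]).
  move=> a b r h; rewrite /T /= !smulA; last 2 first.
  - by apply: additive_factor => c v w; rewrite scalerDr !scalerA mulrC.
  - by apply: additive_factor => c v w; rewrite scalerDr !scalerA mulrC.
  rewrite tpermL tpermR; apply: (@intertwines_smul _ _ f) => //.
  exact: yang_baxter_pair.
rewrite /scalar_Tser /Tser enumE.
move: ni nj; rewrite !mem_cat !negb_or => /andP[+ _] /andP[+ _].
elim: (s1) => [|l s IHs] //.
rewrite !inE !negb_or ![_ == l]eq_sym => /andP[nli nis] /andP[nlj njs].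
by apply: (@intertwines_smul _ _ f); [exact: T_factor|exact: IHs].
Qed.

End Series.

(** [E] marks the vectors fixed by [K]. On the others, reindexing by the involution [t] collects at
    [F s] the contributions of both members of a pair. *)
Lemma linear_sum_pairs (R : fieldType) (V : lmodType R) (K : {linear V -> V})
    (I : finType) (S E : pred I) (t : I -> I) (A B c : I -> R) (F : I -> V) :
    involutive t ->
    (forall s, S s && ~~ E s = S (t s) && ~~ E (t s)) ->
    (forall s, S s -> E s -> K (F s) = F s) ->
    (forall s, S s -> ~~ E s -> K (F s) = A s *: F s + B s *: F (t s)) ->
  K (\sum_(s | S s) c s *: F s) =
  \sum_(s | S s) (if E s then c s else c s * A s + c (t s) * B (t s)) *: F s.
Proof.
move=> tt SEt KE KnE.
have -> : K (\sum_(s | S s) c s *: F s) = \sum_(s | S s) c s *: K (F s).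
  by rewrite linear_sum; apply: eq_bigr => s _; apply: linearZ.
rewrite (bigID E) [RHS](bigID E) /=; congr (_ + _).
  by apply: eq_bigr => s /andP[sS sE]; rewrite sE KE.
transitivity (\sum_(s | S s && ~~ E s) (c s * A s) *: F s
              + \sum_(s | S s && ~~ E s) (c s * B s) *: F (t s)).
  rewrite -big_split; apply: eq_bigr => s /andP[sS sE].
  by rewrite KnE // scalerDr !scalerA.
rewrite [X in _ + X](reindex_inj (inv_inj tt)) -(eq_bigl _ _ SEt) -big_split.
by apply: eq_bigr => s /andP[_ /negPf ->]; rewrite tt scalerDl.
Qed.

Lemma eq_scalar_Tser (C : numClosedFieldType) N n (x y : 'I_N -> C) :
  x =1 y -> scalar_Tser (n := n) x = scalar_Tser y.
Proof.
move=> eqxy; rewrite /scalar_Tser /Tser; congr foldr.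
by apply: eq_map => i; rewrite eqxy.
Qed.

Lemma tens_map_linear (C : numClosedFieldType) N n (X Y : lmodType C)
    (f : {linear X -> Y}) (c : C) (h h' : tens N n X) :
  [ffun eta => f ((c *: h + h') eta)] =
  c *: ([ffun eta => f (h eta)] : tens N n Y) + [ffun eta => f (h' eta)].
Proof. by apply/ffunP => eta; rewrite !ffunE linearP. Qed.

(** * Tensors with a polynomial factor *)

Section PolynomialTensor.
Variables (C : numClosedFieldType) (N n : nat) (alpha : C).
Local Notation Vs := (Vsp C N n).
Local Notation Hs := (Hsp C N n).

Lemma ptens_is_linear (p : Lpoly C N) : linear (ptens p : Vs -> Hs).
Proof. by move=> c v w; apply/ffunP => eta; rewrite !ffunE scalerDl scalerA. Qed.
HB.instance Definition _ (p : Lpoly C N) :=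
  GRing.isLinear.Build C Vs Hs *:%R (ptens p : Vs -> Hs) (ptens_is_linear p).

Lemma ptens_Eu (p : Lpoly C N) i c d (v : Vs) :
  ptens p (Eu i c d v) = Eu i c d (ptens p v).
Proof. by apply/ffunP => eta; rewrite !ffunE; case: ifP; rewrite ?ffunE ?scale0r. Qed.

Lemma dH_linear i c (h h' : Hs) :
  dH alpha i (c *: h + h') = c *: dH alpha i h + dH alpha i h'.
Proof. exact: (tens_map_linear (@dunkl C N alpha i)). Qed.

Lemma dH_ptens i (x : C) (p : Lpoly C N) (v : Vs) :
  dunkl alpha i p = x *: p -> dH alpha i (ptens p v) = ptens p (x *: v).
Proof.
move=> eig; apply/ffunP => eta; rewrite !ffunE.
have -> : dunkl alpha i (v eta *: p) = v eta *: dunkl alpha i p by apply: linearZ.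
by rewrite eig scalerA mulrC.
Qed.

(** With a joint eigenvector as polynomial factor, every [d_i] acts as a scalar in each factor of
    the product. *)
Lemma ptens_That (x : 'I_N -> C) (p : Lpoly C N) :
    (forall i, dunkl alpha i p = x i *: p) ->
  intertwines (ptens p : Vs -> Hs) (scalar_Tser x) (That alpha).
Proof.
move=> eig; rewrite /scalar_Tser /That /Tser.
elim: (enum _) => [|i s IHs] /=; first exact: intertwines_one.
apply: intertwines_smul IHs; apply: intertwines_factor => [c d v|v].
  exact: ptens_Eu.
by rewrite (dH_ptens _ (eig i)).
Qed.

End PolynomialTensor.

(** * Antisymmetric tensors and the map U *)

Section Main.
Variables (C : numClosedFieldType) (N n : nat) (alpha : C).
Hypothesis alpha_gt0 : 0 < alpha.
Variables (m : expo N) (Phi : {perm 'I_N} -> Lpoly C N).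
Hypotheses (m_dec : nonincr m) (PhiP : PhiSpec alpha m Phi).
Local Notation Vs := (Vsp C N n).
Local Notation Hs := (Hsp C N n).
Local Notation xi := (xi alpha m).
Implicit Types (v : {perm 'I_N} -> Vs) (s : {perm 'I_N}) (i j : 'I_N).

(** Extends [Umap] to arbitrary components, so that one criterion for H^(-) serves both the image of
    U and surjectivity. *)
Definition jack_tens v : Hs := \sum_(s : {perm 'I_N} | inS m s) ptens (Phi s) (v s).

Lemma jack_tensE v eta : jack_tens v eta = \sum_(s | inS m s) v s eta *: Phi s.
Proof. by rewrite sum_ffunE; apply: eq_bigr => s _; rewrite ffunE. Qed.

Lemma eq_jack_tens v v' :
  (forall s, inS m s -> v s = v' s) -> jack_tens v = jack_tens v'.
Proof. by move=> eqv; apply: eq_bigr => s sS; rewrite eqv. Qed.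

Lemma jack_tens_inj v v' : jack_tens v = jack_tens v' ->
  forall s, inS m s -> v s = v' s.
Proof.
move=> eqh s sS; apply/ffunP => eta; apply/eqP; rewrite -subr_eq0; apply/eqP.
apply: (Phi_free alpha_gt0 PhiP (c := fun s => v s eta - v' s eta)) => //.
rewrite (eq_bigr _ (fun s _ => scalerBl _ _ _)) sumrB.
by apply/eqP; rewrite subr_eq0 -!jack_tensE eqh.
Qed.

Lemma jack_tensN v : jack_tens (fun s => - v s) = - jack_tens v.
Proof. by rewrite -sumrN; apply: eq_bigr => s _; apply: linearN. Qed.

Section Adjacent.
Variables (i j : 'I_N).
Hypothesis ji : nat_of_ord j = i.+1.
Local Notation t := (tperm i j).
Local Notation P := (@Pperm C N n C^o t).

Lemma inS_adjacentE s :
  inS m s && (m (s i) != m (s j)) =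
  inS m (t * s)%g && (m ((t * s)%g i) != m ((t * s)%g j)).
Proof.
rewrite !permM tpermL tpermR [m (s j) == _]eq_sym.
have [_|neq_m] := eqVneq (m (s i)) (m (s j)); first by rewrite !andbF.
rewrite !andbT; apply/idP/idP => [sS|tsS]; first exact: inS_adjacent.
have -> : s = (t * (t * s))%g by rewrite mulgA tperm2 mul1g.
by apply: (inS_adjacent ji tsS); rewrite !permM tpermL tpermR eq_sym.
Qed.

Lemma Kpoly_sum_Phi (c : {perm 'I_N} -> C) :
  Kpoly t (\sum_(s | inS m s) c s *: Phi s) =
  \sum_(s | inS m s)
    (if m (s i) == m (s j) then c s
     else c s * Kdiag alpha m i j s
          + c (t * s)%g * Koff alpha m i j (t * s)%g) *: Phi s.
Proof.
apply: (@linear_sum_pairs C _ (Kpoly t)) => [s|s|s sS /eqP eqm|s sS neqm].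
- by rewrite mulgA tperm2 mul1g.
- exact: inS_adjacentE.
- exact: (Kpoly_Phi_eq alpha_gt0 PhiP ji).
- exact: (Kpoly_Phi_neq alpha_gt0 PhiP ji).
Qed.

Lemma KH_Pperm_jack_tens v :
  KH t (Pperm t (jack_tens v)) =
  jack_tens (fun s => if m (s i) == m (s j) then P (v s) else
    Kdiag alpha m i j s *: P (v s) + Koff alpha m i j (t * s)%g *: P (v (t * s)%g)).
Proof.
apply/ffunP => eta; rewrite ffunE ffunE !jack_tensE Kpoly_sum_Phi.
apply: eq_bigr => s _; congr (_ *: _); case: ifP => _; rewrite !ffunE //.
by congr (_ + _); rewrite mulrC.
Qed.

(** Coefficients of each [Phi s] are compared. Equal exponents give the antisymmetry. At a descent
    the off-diagonal entry entering from [t * s] is 1, so the equation can be solved for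
    [v (t * s)], which yields the recursion. *)
Lemma inHm_adjacentP v :
  KH t (Pperm t (jack_tens v)) = - jack_tens v <->
  forall s, inS m s ->
    (m (s i) = m (s j) -> P (v s) = - v s) /\
    (m (s j) < m (s i) -> v (t * s)%g = - Rcheck i j (xi s i - xi s j) (v s)).
Proof.
have PZ c u : P (c *: u) = c *: P u by apply: linearZ.
have PN u : P (- u) = - P u by apply: linearN.
have PD u w : P (u + w) = P u + P w by apply: linearD.
rewrite KH_Pperm_jack_tens -jack_tensN; split=> [/jack_tens_inj eqv s sS|eqv].
  have := eqv s sS; split=> [eqm|ltm]; first by move: H; rewrite eqm eqxx.
  move: H; rewrite gt_eqF // /Koff !permM tpermL tpermR ltm scale1r.
  move=> /(canRL (addKr _)) /(congr1 P); rewrite Pperm_tpermK => ->.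
  by rewrite PD !PN PZ Pperm_tpermK /Rcheck opprD addrC.
apply: eq_jack_tens => s sS; case: (ltgtP (m (s i)) (m (s j))) => [ltm|gtm|eqm].
(* At an ascent the equation follows from the recursion leading from [t * s] to [s]: the square of
   the diagonal entry cancels the one in [Koff]. *)
- have neqm : m (s i) != m (s j) by rewrite lt_eqF.
  have tsS := inS_adjacent ji sS neqm.
  have [_] := eqv _ tsS; rewrite mulgA tperm2 mul1g !permM tpermL tpermR => /(_ ltm).
  set w := v (t * s)%g => ->.
  rewrite /Koff /Kdiag !permM tpermL tpermR ltNge (ltW ltm) /= /Rcheck.
  rewrite /Defs.xi !permM tpermL tpermR.
  set x := (_ - _)^-1; set y := (_ - _)^-1.
  have -> : x = - y by rewrite /x -[X in X^-1]opprB invrN.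
  rewrite PN PD PZ Pperm_tpermK scalerN scaleNr !opprK scalerDr scalerA -expr2.
  by rewrite scalerBl scale1r addrC addrA -(addrA (P w)) addrC addrA subrK addrC.
- have := (eqv _ sS).2 gtm; rewrite /Koff !permM tpermL tpermR gtm scale1r => ->.
  by rewrite PN PD PZ Pperm_tpermK opprD /Kdiag addrA subrr add0r.
- by have := (eqv _ sS).1 eqm.
Qed.

End Adjacent.

Lemma inHm_jack_tensP v :
  inHm (jack_tens v) <->
  forall i j s, nat_of_ord j = i.+1 -> inS m s ->
    (m (s i) = m (s j) -> Pperm (tperm i j) (v s) = - v s) /\
    (m (s j) < m (s i) ->
       v (tperm i j * s)%g = - Rcheck i j (xi s i - xi s j) (v s)).
Proof.
split=> [vH i j s ji sS|vP i j ji].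
  exact: ((inHm_adjacentP ji v).1 (vH _ _ ji) s sS).
by apply: (inHm_adjacentP ji v).2 => s; apply: vP.
Qed.

Variable R : {perm 'I_N} -> Vs -> Vs.
Hypothesis RP : RSpec alpha m R.

Lemma R_step s i j w : inS m s -> nat_of_ord j = i.+1 -> m (s j) < m (s i) ->
  R (tperm i j * s)%g w = - Rcheck i j (xi s i - xi s j) (R s w).
Proof. by move=> sS ji ltm; apply: RP.2. Qed.

(** [R] is known only through its recursion, so linearity too needs induction along S^m. *)
Lemma R_linear s : inS m s -> forall c w w', R s (c *: w + w') = c *: R s w + R s w'.
Proof.
move: s; apply: inS_ind => [c w w'|s i j sS ji ltm IHs c w w'].
  by rewrite !RP.1.
rewrite !(R_step _ sS ji ltm) IHs //.
by rewrite [Rcheck _ _ _ _]linearP opprD scalerN.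
Qed.

Lemma xi_neq s i j : inS m s -> i != j -> xi s i - xi s j != 0.
Proof. by move=> sS nij; rewrite !xiE //; apply: eigenvalue_neq. Qed.

Lemma R_scalar_Tser s a b r w : inS m s ->
  R s (scalar_Tser (xi 1%g) a b r w) = scalar_Tser (xi s) a b r (R s w).
Proof.
move: s; apply: inS_ind => [|s i j sS ji ltm IHs]; first by rewrite !RP.1.
have nx : xi s i != xi s j by rewrite -subr_eq0 xi_neq // adjacent_neq.
rewrite !(R_step _ sS ji ltm) IHs // (Rcheck_scalar_Tser ji nx).
rewrite (seriesN (@scalar_Tser_additive _ _ _ _)); congr (- _).
rewrite (@eq_scalar_Tser _ _ _ _ (xi (tperm i j * s)%g)) // => l.
by rewrite /= /Defs.xi permM.
Qed.

(** Two steps carry the equal exponents from the positions k, l to the overlapping pair i, j. The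
    R-matrices applied have parameters [x] and [x + 1], as [yang_baxter_antisym] demands. *)
Lemma R_two_steps s i j k l w : let t := tperm i j in let t' := tperm k l in
    inS m s -> nat_of_ord j = i.+1 -> nat_of_ord l = k.+1 ->
    j = k \/ i = l -> m (s j) < m (s i) ->
    m ((t * s)%g l) < m ((t * s)%g k) ->
    Pperm t' (R s w) = - R s w ->
    xi s k - xi s l = 1 ->
  Pperm t (R (t' * (t * s))%g w) = - R (t' * (t * s))%g w.
Proof.
move=> t t' sS ji lk adj ltm ltm' asym xi1.
have neq_m : m (s i) != m (s j) by rewrite gt_eqF.
have tsS := inS_adjacent ji sS neq_m.
rewrite (R_step w tsS lk ltm') (R_step w sS ji ltm).
set x := xi s i - xi s j.
(* The first step replaces the shared position by the far end of the three, so the new gap is the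
   old one plus the gap 1 between k and l. *)
have xE : xi (t * s)%g k - xi (t * s)%g l = x + 1.
  rewrite -xi1 /x; have {xi1 asym ltm'} := adj.
  have xit l' : xi (t * s)%g l' = xi s (t l') by rewrite /Defs.xi permM.
  rewrite !xit; case=> [jk|il].
    have nil : i != l by rewrite -val_eqE /= lk -jk ji; lia.
    have njl : j != l by rewrite -val_eqE /= lk -jk; lia.
    by rewrite (tpermD nil njl) -jk tpermR addrA subrK.
  have nik : i != k by rewrite -val_eqE /= il lk; lia.
  have njk : j != k by rewrite -val_eqE /= ji il lk; lia.
  by rewrite (tpermD nik njk) -il tpermL [RHS]addrC addrA subrK.
have nx : x != 0 by rewrite xi_neq // adjacent_neq.
have nx1 : x + 1 != 0 by rewrite -xE; apply: xi_neq tsS (adjacent_neq lk).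
have braid (u : Vs) : Pperm t (Pperm t' (Pperm t u)) = Pperm t' (Pperm t (Pperm t' u)).
  rewrite !PpermM; congr Pperm; rewrite ?mulgA; case: adj => [jk|il].
    rewrite /t /t' -jk; apply: tperm_braid; rewrite -val_eqE /= ?lk -?jk ?ji; lia.
  rewrite /t /t' -il ![tperm k i]tpermC [tperm i j]tpermC.
  by apply: tperm_braid; rewrite -val_eqE /= ?ji il lk; lia.
have RcN (u : Vs) : Rcheck k l (x + 1) (- u) = - Rcheck k l (x + 1) u.
  exact: linearN.
rewrite xE RcN opprK.
exact: (yang_baxter_antisym (A := @Pperm C N n C^o t) (B := @Pperm C N n C^o t')
  (Pperm_tpermK i j) (Pperm_tpermK k l) braid nx nx1 asym).
Qed.

Lemma R_antisym w : inW m w -> forall s, inS m s ->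
  forall k l : 'I_N, nat_of_ord l = k.+1 -> m (s k) = m (s l) ->
  Pperm (tperm k l) (R s w) = - R s w.
Proof.
move=> wW; apply: inS_ind => [k l lk|s i j sS ji ltm IHs k l lk eqm].
  by rewrite !perm1 RP.1; apply: wW.
(* When the pairs k, l and i, j share one position, [s] is itself a step above [s2], where the equal
   exponents sit at i, j; the induction hypothesis covers [s2], whose height is smaller. *)
pose s2 := (tperm k l * s)%g.
have sE : s = (tperm k l * s2)%g by rewrite mulgA tperm2 mul1g.
have two_steps : j = k \/ l = i -> m (s k) < m (s l) -> m (s2 i) = m (s2 j) ->
    Pperm (tperm k l) (R (tperm i j * s)%g w) = - R (tperm i j * s)%g w.
  move=> adj lt_kl eq_ij.
  have s2S : inS m s2 by apply: inS_adjacent => //; rewrite lt_eqF.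
  have lt_s2 : m (s2 l) < m (s2 k) by rewrite !permM tpermL tpermR.
  rewrite {1 2}sE; apply: R_two_steps => //.
  - by case: adj; [right|left].
  - by rewrite -sE.
  - apply: IHs => //; rewrite [in leqRHS]sE; apply: ltnW.
    exact: (inS_height_adjacent s2S lk lt_s2).
  - exact: (xi_adjacent_eq alpha ji s2S eq_ij).
have vE (a b : 'I_N) : (a == b) = (a == b :> nat) by [].
have [ik|nik] := eqVneq i k.
  have jl : j = l by apply: val_inj; rewrite /= ji lk ik.
  by move: eqm; rewrite -ik -jl !permM tpermL tpermR => eqm; rewrite eqm ltxx in ltm.
have [jk|njk] := eqVneq j k.
  have nil : i != l by rewrite vE lk -jk ji; lia.
  have njl : j != l by rewrite vE lk -jk; lia.
  have eq_il : m (s i) = m (s l).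
    by move: eqm; rewrite -jk !permM tpermR (tpermD nil njl).
  apply: two_steps; first by left.
    by rewrite -jk -eq_il.
  by rewrite !permM -jk tpermL tpermD // eq_sym // adjacent_neq.
have [il|nil] := eqVneq i l.
  have eq_kj : m (s k) = m (s j).
    by move: eqm; rewrite -il !permM tpermL tpermD.
  have njl : j != l by rewrite -il eq_sym adjacent_neq.
  apply: two_steps; first by right.
    by rewrite -il eq_kj.
  by rewrite !permM il tpermR tpermD // eq_sym.
(* From here the pairs are disjoint, and [P_(k,l)] commutes with [Rcheck i j]. *)
have njl : j != l by move: nik; rewrite !vE ji lk; lia.
have ski : (tperm i j * s)%g k = s k by rewrite permM tpermD.
have sli : (tperm i j * s)%g l = s l by rewrite permM tpermD.
rewrite (R_step w sS ji ltm); set u := R s w.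
have asym : Pperm (tperm k l) u = - u by apply: IHs => //; rewrite -ski -sli.
have tt : (tperm k l * tperm i j = tperm i j * tperm k l)%g.
  have -> : (tperm k l * tperm i j)%g = (tperm i j * (tperm k l) ^ (tperm i j))%g.
    by rewrite /conjg !mulgA tpermV tperm2 mul1g.
  by rewrite tpermJ !tpermD.
have PN (v : Vs) : Pperm (tperm k l) (- v) = - Pperm (tperm k l) v by apply: linearN.
have PD (v v' : Vs) :
    Pperm (tperm k l) (v + v') = Pperm (tperm k l) v + Pperm (tperm k l) v'.
  exact: linearD.
have PZ c (v : Vs) : Pperm (tperm k l) (c *: v) = c *: Pperm (tperm k l) v.
  exact: linearZ.
have PijN (v : Vs) : Pperm (tperm i j) (- v) = - Pperm (tperm i j) v by apply: linearN.
rewrite PN /Rcheck PD PZ PpermM tt -PpermM asym PijN scalerN -opprD.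
by [].
Qed.

Lemma Umap_inF w : inW m w -> inF m Phi (Umap m Phi R w).
Proof.
move=> wW; split; first by exists (R ^~ w).
apply/inHm_jack_tensP => i j s ji sS; split=> [eqm|ltm].
  exact: R_antisym.
exact: R_step.
Qed.

Lemma Umap_linear c w w' :
  Umap m Phi R (c *: w + w') = c *: Umap m Phi R w + Umap m Phi R w'.
Proof.
rewrite /Umap scaler_sumr -big_split; apply: eq_bigr => s sS.
by rewrite R_linear //; apply: linearP.
Qed.

Lemma Umap_inj : injective (Umap m Phi R : Vs -> Hs).
Proof.
by move=> w w' /jack_tens_inj /(_ _ (inS1 m_dec)); rewrite !RP.1.
Qed.

(** The preimage is the component at the identity: membership in H^(-) makes it antisymmetric where
    [m] has equal neighbours, and the recursion then forces all other components. *)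
Lemma Umap_surj h : inF m Phi h -> exists2 w, inW m w & Umap m Phi R w = h.
Proof.
case=> -[v ->] /inHm_jack_tensP vP; have S1 := inS1 m_dec; exists (v 1%g).
  move=> i j ji eqm; apply: (vP i j 1%g ji S1).1; by rewrite !perm1.
apply: eq_jack_tens; apply: inS_ind => [|s i j sS ji ltm IHs]; first exact: RP.1.
by rewrite (R_step _ sS ji ltm) IHs // (vP i j s ji sS).2.
Qed.

Lemma Umap_intertwines w a b r :
  Umap m Phi R (TW alpha m a b r w) = That alpha a b r (Umap m Phi R w).
Proof.
rewrite /Umap /That series_sum; last by apply: additive_foldr; apply: dH_linear.
apply: eq_bigr => s sS.
rewrite -[TW alpha m]/(scalar_Tser (xi 1%g)) R_scalar_Tser //.
by apply: ptens_That; apply: (PhiP sS).1.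
Qed.

End Main.

Theorem theorem1 (C : numClosedFieldType) (N n : nat) (alpha : C)
  (HN : (0 < N)%N) (Hn : (0 < n)%N) (Halpha : 0 < alpha)
  (m : expo N) (Hm : nonincr m)
  (Phi : {perm 'I_N} -> Lpoly C N) (HPhi : PhiSpec alpha m Phi)
  (R : {perm 'I_N} -> Vsp C N n -> Vsp C N n) (HR : RSpec alpha m R) :
  let U := Umap m Phi R in
  (* U maps W^m_(-) into F^m *)
  (forall w, inW m w -> inF m Phi (U w)) /\
  (* U is linear *)
  (forall (c : C) (v1 v2 : Vsp C N n), U (c *: v1 + v2) = c *: U v1 + U v2) /\
  (* U is injective on W^m_(-) *)
  (forall w1 w2, inW m w1 -> inW m w2 -> U w1 = U w2 -> w1 = w2) /\
  (* U maps W^m_(-) onto F^m *)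
  (forall h, inF m Phi h -> exists2 w, inW m w & U w = h) /\
  (* U intertwines the Yangian actions, coefficientwise in u^{-1} *)
  (forall w, inW m w -> forall (a b : 'I_n) (r : nat),
     U (TW alpha m a b r w) = That alpha a b r (U w)).
Proof.
move=> U; split; first by move=> w wW; exact: (Umap_inF Halpha HPhi HR wW).
split; first by move=> c v1 v2; apply: (Umap_linear Phi HR).
split; first by move=> w1 w2 _ _; exact: (Umap_inj Halpha Hm HPhi HR).
split; first by move=> h hF; exact: (Umap_surj Halpha Hm HPhi HR hF).
by move=> w _ a b r; exact: (Umap_intertwines Halpha HPhi HR).
Qed.
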